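(* The differential $\mathrm d$ of the complete $s\mathcal L_\infty$-algebra $\mathrm{mc}^1$ is given on its degree $1$ generator $a_{01}$ by $$\mathrm d(a_{01})=a_1-a_0+\sum_{\tau\in\mathrm{PaPT}}\frac1{D(\tau)}\,\tau^{a_{01}}(a_0,\,a_1-a_0).$$
   Context: **Trees.** Planar rooted trees here may have vertices of any arity $\geq 0$ (number of incoming edges); $|$ is the trivial tree and $\mathrm c_m$ the corolla with $m$ leaves. For a planar rooted tree $\tau$ with $|\tau|$ vertices, the coefficient $C(\tau)$ is defined recursively by $C(|)=1$, $C(\mathrm c_m)=m!$, and $C(\tau)=m!\,|\tau|\prod_{i=1}^mC(\tau_i)$ if $\tau=\mathrm c_m\circ(\tau_1,\ldots,\tau_m)$. $\mathrm{PaPT}$ is the set of partitioned planar rooted trees: planar rooted trees with at least one vertex, all of whose vertices have arity $\ge1$, with leaves coloured black or white, endowed with a partition of the set of vertices into blocks, each block being a (connected, non-empty) subtree. If $\tau\in\mathrm{PaPT}$ has blocks giving planar rooted subtrees $\tau^1,\ldots,\tau^k$, let $\tilde\tau^i$ be the planar rooted tree obtained from $\tau^i$ by replacing by a vertex of arity $0$ each of its leaves that is connected in $\tau$ to another block or is a black leaf (white leaves remain leaves); put $D(\tau)=(-1)^k\prod_{i=1}^kC(\tilde\tau^i)$. For $\alpha,\beta,\lambda$ in an $s\mathcal L_\infty$-algebra, $\tau^\lambda(\alpha,\beta)$ is defined recursively (forgetting the partition): it is $\alpha$ for a white leaf, $\beta$ for a black leaf, and $\ell_{m+1}(\tau_1^\lambda(\alpha,\beta),\ldots,\tau_m^\lambda(\alpha,\beta),\lambda)$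 if $\tau=\mathrm c_m\circ(\tau_1,\ldots,\tau_m)$. **Complete $s\mathcal L_\infty$-algebras.** $\mathbb K$ is a field of characteristic $0$; chain complexes are $\mathbb Z$-graded with differential of degree $-1$. A complete $s\mathcal L_\infty$-algebra is a chain complex $\mathfrak g$ with a complete descending filtration by subcomplexes, $\mathfrak g=F_0\mathfrak g=F_1\mathfrak g\supseteq F_2\mathfrak g\supseteq\cdots$, $\mathfrak g\cong\lim_k\mathfrak g/F_k\mathfrak g$ degreewise, and filtration-preserving graded symmetric operations $\ell_m:\mathfrak g^{\otimes m}\to\mathfrak g$ of degree $-1$, $m\ge2$, satisfying, with $\ell_1=d$, the shifted $L_\infty$-relations $\sum_{p+q=m+1}\sum\pm\,\ell_p(\ell_q(\ldots),\ldots)=0$; equivalently an algebra over the operad $s\mathcal L_\infty=\Omega\mathrm{Com}^\vee$ below. **Operads.** (Co)operads $\mathcal M$ satisfy $\mathcal M(0)=0$, $\mathcal M(1)=\mathbb K\,\mathrm{id}$; $\mathrm B$, $\Omega$ are the operadic bar and cobar constructions. $\mathrm{Com}$ is the operad of (non-unital) commutative algebras, $\mathrm{Com}(m)=\mathbb K\mu_m$, $m\geq 1$, $\mathrm{Com}^\vee$ its linear dual; $s\mathcal L_\infty=\Omega\mathrm{Com}^\vee$, the generator $s^{-1}\mu_m^\vee$ acting as $\ell_m$. $\pi:\mathrm B\Omega\mathrm{Com}^\vee\to\Omega\mathrm{Com}^\vee$ is the universal operadic twisting morphism (projection onto cogenerators followed by desuspension). **Homotopy transfer.** A contraction of $X$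 onto $Y$ consists of chain maps $i:Y\to X$, $p:X\to Y$ and a degree $1$ map $h$ on $X$ with $pi=\mathrm{id}$, $ip-\mathrm{id}=dh+hd$, $h^2=0$, $ph=0$, $hi=0$. An $\Omega\mathcal C$-algebra structure on $X$ is encoded by a twisting morphism $\varphi_X:\mathcal C\to\mathrm{End}_X$; the transferred structure on $Y$ is $\varphi_Y=\mathrm{VdL}_h\circ\mathcal T(s\varphi_X)\circ\Delta^{\mathrm{mon}}_{\mathcal C}$, where $\Delta^{\mathrm{mon}}_{\mathcal C}:\mathcal C\to\mathcal T(\mathcal C)$ is the full decomposition into trees and $\mathrm{VdL}_h$ composes along a tree with $i$ on leaves, $h$ on internal edges, $p$ at the root. **The algebra $\mathrm{mc}^n$.** $[n]=\{0,\ldots,n\}$, $\Omega_n=\mathbb K[t_0,\ldots,t_n,dt_0,\ldots,dt_n]/(\sum t_i-1,\sum dt_i)$. $\mathrm C^n=C(\Delta^n)$ is the cellular chain complex of the $n$-simplex, with basis $a_I$ ($\emptyset\ne I\subseteq[n]$, $|a_I|=|I|-1$), and $\mathrm C_n=C(\Delta^n)^\vee$ has dual basis $\omega_I$. The Dupont contraction $(i_n,p_n,h_n)$ of $\Omega_n$ onto $\mathrm C_n$: $i_n(\omega_{i_0\cdots i_k})=k!\sum_j(-1)^jt_{i_j}dt_{i_0}\cdots\widehat{dt_{i_j}}\cdots dt_{i_k}$, $p_n$ is integration over faces, and, up to the global sign fixed by $i_np_n-\mathrm{id}=dh_n+h_nd$, $h_n=\sum_{k=0}^{n-1}\sum_{i_0<\cdots<i_k}\omega_{i_0\cdots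 i_k}h^{i_k}\cdots h^{i_0}$, with $h^i$ the Poincaré homotopy for the linear contraction of $\Delta^n$ onto its $i$-th vertex. The commutative algebra $\Omega_n$ is an $\Omega\mathrm B\mathrm{Com}$-algebra via $\Omega\mathrm B\mathrm{Com}\to\mathrm{Com}$; transfer along the Dupont contraction makes $\mathrm C_n$ an $\Omega\mathrm B\mathrm{Com}$-algebra, and dually $\mathrm C^n$ a $\mathrm B\Omega\mathrm{Com}^\vee$-coalgebra. Then $\mathrm{mc}^n=\widehat\Omega_\pi\mathrm C^n=(\widehat{s\mathcal L_\infty}(\mathrm C^n),\mathrm d=d_1+d_2)$, with $\widehat{s\mathcal L_\infty}(V)=\prod_{m\ge1}s\mathcal L_\infty(m)\otimes_{\mathbb S_m}V^{\otimes m}$ the free complete $s\mathcal L_\infty$-algebra, $d_1$ induced by the internal differentials and $-d_2$ the derivation extending $\mathrm C^n\xrightarrow{\Delta}\widehat{\mathrm B\Omega\mathrm{Com}^\vee}(\mathrm C^n)\xrightarrow{\pi(\mathrm{id})}\widehat{s\mathcal L_\infty}(\mathrm C^n)$. In particular $\mathrm{mc}^1$ is free as a complete graded $s\mathcal L_\infty$-algebra on $a_0,a_1$ (degree $0$) and $a_{01}$ (degree $1$). *)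

(* Defs.v *)
From HB Require Import structures.
From mathcomp Require Import all_boot all_order all_algebra.
From mathcomp Require Import ring.

Set Implicit Arguments.
Unset Strict Implicit.
Unset Printing Implicit Defensive.

Import GRing.Theory.

(* [Leaf a] is the trivial tree, its leaf being decorated by [a]. *)
Inductive tree (L A : Type) : Type :=
| Leaf of A
| Node of L & seq (tree L A).
Arguments Leaf {L A} _.
Arguments Node {L A} _ _.

Section TreeEncoding.
Variables L A : Type.

Lemma tree_nested_ind (P : tree L A -> Prop) :
  (forall a, P (Leaf a)) ->
  (forall l ts, foldr (fun t Q => P t /\ Q) True ts -> P (Node l ts)) ->
  forall t, P t.
Proof.
move=> PL PN; fix IH 1; case=> [a|l ts]; first exact: PL.
apply: PN; elim: ts => [|t ts IHts]; first by [].
exact: conj (IH t) IHts.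
Qed.

Fixpoint tree_encode (t : tree L A) : GenTree.tree (L + A) :=
  match t with
  | Leaf a => GenTree.Leaf (inr a)
  | Node l ts => GenTree.Node 0 (GenTree.Leaf (inl l) :: map tree_encode ts)
  end.

Fixpoint tree_decode (g : GenTree.tree (L + A)) : option (tree L A) :=
  match g with
  | GenTree.Leaf (inr a) => Some (Leaf a)
  | GenTree.Node _ (GenTree.Leaf (inl l) :: gs) =>
      Some (Node l (pmap tree_decode gs))
  | _ => None
  end.

Lemma tree_encodeK : pcancel tree_encode tree_decode.
Proof.
elim/tree_nested_ind => [//|l ts IH] /=; congr (Some (Node l _)).
by elim: ts IH => //= t ts IHts [-> /IHts /= ->].
Qed.

End TreeEncoding.

HB.instance Definition _ (L A : eqType) :=
  Equality.copy (tree L A) (pcan_type (@tree_encodeK L A)).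

Section TreeStatistics.
Variables L A : Type.
Implicit Type t : tree L A.

Definition is_leaf t : bool := if t is Leaf _ then true else false.

Fixpoint leaves t : seq A :=
  match t with
  | Leaf a => [:: a]
  | Node _ ts => flatten (map leaves ts)
  end.

Definition nleaves t : nat := size (leaves t).

Fixpoint nnodes t : nat :=
  match t with
  | Leaf _ => 0
  | Node _ ts => (sumn (map nnodes ts)).+1
  end.

Fixpoint arities t : seq nat :=
  match t with
  | Leaf _ => [::]
  | Node _ ts => size ts :: flatten (map arities ts)
  end.

Definition reduced t : bool := all (leq 2) (arities t).

End TreeStatistics.

Fixpoint Ccoef (t : tree unit unit) : nat :=
  match t with
  | Leaf _ => 1
  | Node _ ts => (size ts)`! * nnodes t * \prod_(c <- map Ccoef ts) c
  end.

(* A partition of the vertices of a tree into connected subtrees amounts to the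
   choice of the internal edges joining two different blocks.  The label of a
   vertex is [true] when it is the lowest vertex of its block, i.e., when it is
   the root or when its outgoing edge joins two blocks.  A leaf is [true] when
   it is black and [false] when it is white. *)
Definition is_papt (t : tree bool bool) : bool :=
  if t is Node true _ then all (leq 1) (arities t) else false.

Definition papt : Type := {t : tree bool bool | is_papt t}.

(* The subtree of a block above one of its incoming edges, with arity 0
   vertices in place of the black leaves and of the edges to other blocks. *)
Fixpoint block_above (t : tree bool bool) : tree unit unit :=
  match t with
  | Leaf black => if black then Node tt [::] else Leaf tt
  | Node lowest ts => Node tt (if lowest then [::] else map block_above ts)
  end.

Fixpoint blocks (t : tree bool bool) : seq (tree unit unit) :=
  match t with
  | Leaf _ => [::]
  | Node lowest ts =>
      (if lowest then [:: Node tt (map block_above ts)] else [::])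
        ++ flatten (map blocks ts)
  end.

(* The sign exponent in (f_1 (x) ... (x) f_k)(x_1 (x) ... (x) x_k), from the
   pairs (degree of f_i, degree of x_i); degrees only matter modulo 2. *)
Fixpoint koszul (l : seq (nat * nat)) : nat :=
  match l with
  | [::] => 0
  | p :: l' => p.2 * sumn (map fst l') + koszul l'
  end.

Fixpoint inversions (s : seq nat) : nat :=
  match s with
  | [::] => 0
  | n :: s' => count (fun m => m < n) s' + inversions s'
  end.

(* The basis elements a_0, a_1, a_01 of the cellular chains of the 1-simplex,
   which also index the dual basis omega_0, omega_1, omega_01. *)
Variant cell := V0 | V1 | E01.

Definition cell_code (c : cell) : nat :=
  match c with V0 => 0 | V1 => 1 | E01 => 2 end.
Lemma cell_codeK :
  pcancel cell_code (nth None [:: Some V0; Some V1; Some E01]).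
Proof. by case. Qed.
HB.instance Definition _ := Equality.copy cell (pcan_type cell_codeK).

Definition dim (c : cell) : nat := if c is E01 then 1 else 0.

Definition in_dim L (t : tree L cell) : nat := sumn (map dim (leaves t)).

(* The degree modulo 2 of an iterated operation evaluated on a_0, a_1, a_01,
   each operation being of degree -1. *)
Definition tdeg (t : tree unit cell) : nat := nnodes t + in_dim t.

Definition choices T (ss : seq (seq T)) : seq (seq T) :=
  foldr (fun s acc => [seq x :: xs | x <- s, xs <- acc]) [:: [::]] ss.

Section Partitions.
Variable A : Type.

Fixpoint markings (t : tree unit A) : seq (tree bool A) :=
  match t with
  | Leaf a => [:: Leaf a]
  | Node _ ts =>
      [seq Node b ms | b <- [:: true; false], ms <- choices (map markings ts)]
  end.

(* All partitions of the vertices of t into subtrees, encoded as for [papt]. *)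
Definition partitions (t : tree unit A) : seq (tree bool A) :=
  match t with
  | Leaf _ => [::]
  | Node _ ts => [seq Node true ms | ms <- choices (map markings ts)]
  end.

(* For the vertices in prefix order, the position (in the same order) of the
   lowest vertex of their block; [pos] is the position of the first vertex of t
   and [low] the lowest vertex of the block of its parent. *)
Fixpoint block_ids (low pos : nat) (t : tree bool A) : seq nat :=
  match t with
  | Leaf _ => [::]
  | Node lowest ts =>
      let b := if lowest then pos else low in
      b :: (fix ids pos ts :=
              match ts with
              | [::] => [::]
              | t :: ts' => block_ids b pos t ++ ids (pos + nnodes t) ts'
              end) pos.+1 ts
  end.

(* The sign exponent in the full decomposition B Com -> T(B Com): the vertices
   of an element of B Com = T^c(s Com) have degree 1 and are ordered by
   prefix order; they are reordered block after block. *)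
Definition partition_sign (t : tree bool A) : nat :=
  inversions (block_ids 0 0 t).

End Partitions.

Local Open Scope ring_scope.

Definition Dcoef (K : fieldType) (t : tree bool bool) : K :=
  (-1) ^+ size (blocks t) * \prod_(b <- blocks t) (Ccoef b)%:R.

Section Dupont.
Variable K : fieldType.

(* The pair (f, g) stands for f + g dt, where t = t_1 and t_0 = 1 - t.  This
   is not the product ring: see [omul]. *)
Definition Omega1 : Type := ({poly K} * {poly K})%type.
Implicit Types w : Omega1.

Definition oone : Omega1 := (1, 0).
Definition omul w w' : Omega1 := (w.1 * w'.1, w.1 * w'.2 + w.2 * w'.1).
Definition oscale (a : K) w : Omega1 := (a *: w.1, a *: w.2).
Definition odiff w : Omega1 := (0, w.1^`()).

Definition t0 : Omega1 := (1 - 'X, 0).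
Definition t1 : Omega1 := ('X, 0).

(* The primitive vanishing at 0. *)
Definition prim (g : {poly K}) : {poly K} :=
  \sum_(k < size g) (g`_k / k.+1%:R) *: 'X^(k.+1).

Definition dupont_i (c : cell) : Omega1 :=
  match c with
  | V0 => t0
  | V1 => t1
  | E01 => omul t0 (odiff t1) - omul t1 (odiff t0)
  end.

Definition dupont_p w (c : cell) : K :=
  match c with
  | V0 => w.1.[0]
  | V1 => w.1.[1]
  | E01 => (prim w.2).[1]
  end.

(* The homotopy for the contraction (u, t) |-> u t + (1 - u) e of the interval
   onto its end point e sends g dt to the primitive of g vanishing at e. *)
Definition poincare (e : K) w : Omega1 := (prim w.2 - (prim w.2).[e]%:P, 0).

Definition dupont_h w : Omega1 :=
  - (omul t0 (poincare 0 w) + omul t1 (poincare 1 w)).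

(* The linear extension of [dupont_i] to C_1, and the differential of C_1. *)
Definition dupont_i_lin (y : cell -> K) : Omega1 :=
  \sum_(c <- [:: V0; V1; E01]) oscale (y c) (dupont_i c).

Definition cochain_diff (y : cell -> K) (c : cell) : K :=
  if c is E01 then y V1 - y V0 else 0.

End Dupont.

Section DupontContraction.
Variables (K : fieldType) (charK0 : [pchar K] =i pred0).

Lemma coef_prim (g : {poly K}) i :
  (prim g)`_i = if i is k.+1 then g`_k / k.+1%:R else 0.
Proof.
rewrite /prim coef_sum; case: i => [|k].
  by apply: big1 => j _; rewrite coefZ coefXn mulr0.
case: (ltnP k (size g)) => lt_k.
  rewrite (bigD1 (Ordinal lt_k)) //= coefZ coefXn eqxx mulr1.
  rewrite big1 ?addr0 // => j ne_j; rewrite coefZ coefXn eqSS.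
  case: eqP => [eq_k|]; last by rewrite mulr0.
  by case/eqP: ne_j; apply: val_inj.
rewrite nth_default // mul0r big1 // => j _; rewrite coefZ coefXn eqSS.
by rewrite gtn_eqF ?mulr0 // (leq_trans (ltn_ord j)).
Qed.

Lemma prim0 : prim (0 : {poly K}) = 0.
Proof. by rewrite /prim size_poly0 big_ord0. Qed.

Lemma prim1 : prim (1 : {poly K}) = 'X.
Proof.
apply/polyP => i; rewrite coef_prim coefX; case: i => // k.
by rewrite coef1 eqSS; case: k => [|k]; rewrite ?invr1 ?mulr1 ?mul0r.
Qed.

Lemma primZ (a : K) (g : {poly K}) : prim (a *: g) = a *: prim g.
Proof.
apply/polyP => i; rewrite coefZ !coef_prim; case: i => [|k].
  by rewrite mulr0.
by rewrite coefZ mulrA.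
Qed.

Let natS_neq0 k : k.+1%:R != 0 :> K.
Proof. by rewrite (proj1 (pcharf0P K) charK0). Qed.

Lemma deriv_prim (g : {poly K}) : (prim g)^`() = g.
Proof.
by apply/polyP => i; rewrite coef_deriv coef_prim -[_ *+ _]mulr_natr divfK.
Qed.

Lemma prim_deriv (f : {poly K}) : prim f^`() = f - f.[0]%:P.
Proof.
apply/polyP => i; rewrite coefB coefC coef_prim horner_coef0.
case: i => [|k]; first by rewrite subrr.
by rewrite coef_deriv -[_ *+ _]mulr_natr mulfK // subr0.
Qed.

Lemma Omega1_eq (w w' : Omega1 K) : w.1 = w'.1 -> w.2 = w'.2 -> w = w'.
Proof. by case: w w' => [f g] [f' g'] /= -> ->. Qed.

Lemma dupont_hE (w : Omega1 K) :
  dupont_h w = ((prim w.2).[1] *: 'X - prim w.2, 0).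
Proof.
have p0 : (prim w.2).[0] = 0 by rewrite horner_coef0 coef_prim.
apply: Omega1_eq; rewrite /= ?p0 ?mulr0 ?mul0r ?addr0 ?oppr0 //.
by rewrite -mul_polyC; ring.
Qed.

Lemma dupont_i_linE (y : cell -> K) :
  dupont_i_lin y = ((y V0)%:P + (y V1 - y V0) *: 'X, (y E01)%:P).
Proof.
rewrite /dupont_i_lin 3!big_cons big_nil.
apply: Omega1_eq; rewrite /= ?derivE -!mul_polyC ?polyCB; ring.
Qed.

Lemma dupont_i_diff (y : cell -> K) :
  dupont_i_lin (cochain_diff y) = odiff (dupont_i_lin y).
Proof.
rewrite !dupont_i_linE /odiff /= subrr scale0r addr0 polyC0.
by rewrite derivD derivC derivZ derivX add0r alg_polyC.
Qed.

Lemma dupont_p_diff (w : Omega1 K) :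
  dupont_p (odiff w) =1 cochain_diff (dupont_p w).
Proof.
case=> /=; [exact: horner0 | exact: horner0 |].
by rewrite prim_deriv hornerD hornerN hornerC.
Qed.

Lemma dupont_pi (y : cell -> K) : dupont_p (dupont_i_lin y) =1 y.
Proof.
rewrite dupont_i_linE; case=> /=.
- by rewrite hornerD hornerC hornerZ hornerX mulr0 addr0.
- by rewrite hornerD hornerC hornerZ hornerX mulr1 addrC subrK.
- by rewrite -alg_polyC primZ prim1 hornerZ hornerX mulr1.
Qed.

Lemma dupont_ip (w : Omega1 K) :
  dupont_i_lin (dupont_p w) - w
  = odiff (dupont_h w) + dupont_h (odiff w).
Proof.
rewrite !dupont_hE dupont_i_linE /odiff /= prim_deriv.
apply: Omega1_eq => /=.
  rewrite hornerD hornerN hornerC -!mul_polyC polyCB; ring.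
by rewrite derivB derivZ derivX deriv_prim alg_polyC; ring.
Qed.

Lemma dupont_hh (w : Omega1 K) : dupont_h (dupont_h w) = 0.
Proof.
by rewrite !dupont_hE /= prim0 horner0 scale0r subr0.
Qed.

Lemma dupont_ph (w : Omega1 K) : dupont_p (dupont_h w) =1 fun=> 0.
Proof.
rewrite dupont_hE; case=> /=.
- by rewrite hornerD hornerN hornerZ hornerX mulr0 horner_coef0 coef_prim subr0.
- by rewrite hornerD hornerN hornerZ hornerX mulr1 subrr.
- by rewrite prim0 horner0.
Qed.

Lemma dupont_hi (y : cell -> K) : dupont_h (dupont_i_lin y) = 0.
Proof.
rewrite dupont_hE dupont_i_linE /= -alg_polyC primZ prim1.
by rewrite hornerZ hornerX mulr1 subrr.
Qed.

End DupontContraction.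

Section Transfer.
Variable K : fieldType.

(* The twisting morphism B Com -> Com -> End(Omega_1), evaluated on the
   elements of Omega_1 decorating the leaves: it vanishes outside corollas. *)
Definition phi_Omega (b : tree unit (Omega1 K)) : Omega1 K :=
  match b with
  | Node _ ts =>
      if all (@is_leaf _ _) ts then foldr (@omul K) (oone K) (leaves b) else 0
  | Leaf _ => 0
  end.

Fixpoint tree_map L A B (f : A -> B) (t : tree L A) : tree L B :=
  match t with
  | Leaf a => Leaf (f a)
  | Node l ts => Node l (map (tree_map f) ts)
  end.

(* The value of the composite of [phi_Omega] on a block with the operators
   plugged into its leaves.  A leaf carries (w, (p, q)): w is the value of an
   operator of degree p on inputs of total degree q, modulo 2. *)
Definition phi_block (b : tree unit (Omega1 K * (nat * nat))) : Omega1 K :=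
  oscale ((-1) ^+ koszul (map snd (leaves b))) (phi_Omega (tree_map fst b)).

(* The part of the lowest block of a partitioned tree lying above an edge.  The
   suspension of the operation of each block but the lowest one is replaced
   by the homotopy on its outgoing edge, whence operators of degree [nnodes]. *)
Fixpoint vdl_above (t : tree bool cell) :
    tree unit (Omega1 K * (nat * nat)) :=
  match t with
  | Leaf c => Leaf (dupont_i K c, (0%N, dim c))
  | Node lowest ts =>
      let b := Node tt (map vdl_above ts) in
      if lowest then Leaf (dupont_h (phi_block b), (nnodes t, in_dim t)) else b
  end.

(* VdL_h o T(s phi_Omega) on a partitioned tree and on the dual basis elements
   decorating its leaves; [c] selects a coefficient in C_1. *)
Definition vdl (t : tree bool cell) (c : cell) : K :=
  match t with
  | Leaf _ => 0
  | Node _ ts => dupont_p (phi_block (Node tt (map vdl_above ts))) c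
  end.

Definition transferred (u : tree unit cell) (c : cell) : K :=
  \sum_(t <- partitions u) (-1) ^+ partition_sign t * vdl t c.

End Transfer.

Section MC1.
Variable K : fieldType.

(* The free complete graded s L_infty-algebra on a_0, a_1, a_01: a reduced tree
   stands for the iterated operation l_m on the decorations of its leaves, and
   a series for the formal sum of its values times the corresponding trees.
   Trees with k leaves span the component of arity k.  Values on non-reduced
   trees are irrelevant, and series are to be compared with [mc_eq]. *)
Definition series : Type := tree unit cell -> K.
Implicit Types x y : series.

Definition monomial (t : tree unit cell) : series := fun u => (u == t)%:R.

Definition gen (c : cell) : series := monomial (Leaf c).

(* The operation l_m, for m >= 2 the length of [xs]. *)
Definition lop (xs : seq series) : series := fun u =>
  match u with
  | Leaf _ => 0
  | Node _ us =>
      if size us == size xs then \prod_(p <- zip xs us) p.1 p.2 else 0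
  end.

(* Exchanging two consecutive arguments of an operation gives the sign with
   exponent the first argument. *)
Inductive swap : nat -> tree unit cell -> tree unit cell -> Prop :=
| swap_here ss v w ts :
    swap (tdeg v * tdeg w)
         (Node tt (ss ++ v :: w :: ts)) (Node tt (ss ++ w :: v :: ts))
| swap_inside s ss v v' ts :
    swap s v v' -> swap s (Node tt (ss ++ v :: ts)) (Node tt (ss ++ v' :: ts)).

(* The component of arity m vanishes by graded symmetry of the operations. *)
Definition arity_null (m : nat) x : Prop :=
  exists rs : seq ((K * nat) * (tree unit cell * tree unit cell)),
    (forall r, r \in rs -> swap r.1.2 r.2.1 r.2.2) /\
    (forall u, reduced u -> nleaves u = m ->
       x u = \sum_(r <- rs)
               r.1.1 * (monomial r.2.1 u - (-1) ^+ r.1.2 * monomial r.2.2 u)).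

(* The filtration by the arity. *)
Definition mc_filtration (k : nat) x : Prop :=
  forall m, (m < k)%N -> arity_null m x.

Definition mc_eq x y : Prop := forall m, arity_null m (x \- y).

(* The sum of f is x for the topology of the filtration. *)
Definition mc_sum (I : eqType) (f : I -> series) x : Prop :=
  forall k, exists s0 : seq I, forall s : seq I,
    uniq s -> {subset s0 <= s} ->
    mc_filtration k (x \- (fun u => \sum_(i <- s) f i u)).

(* The coefficient of u in the extension of an operator by the rule
   d l(.., v, ..) = .. - (+/-) l(.., d v, ..), where [root] gives the terms
   not coming from this rule. *)
Fixpoint extend_derivation (root : series -> series) x (u : tree unit cell) :
    K :=
  root x u +
  match u with
  | Leaf _ => 0
  | Node _ us =>
      - (fix args pre post :=
           match post with
           | [::] => 0
           | v :: post' =>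
               (-1) ^+ sumn (map tdeg pre)
                 * extend_derivation root
                     (fun v' => x (Node tt (pre ++ v' :: post'))) v
               + args (rcons pre v) post'
           end) [::] us
  end.

Definition root_gens (delta : cell -> series) x : series := fun u =>
  \sum_(c <- [:: V0; V1; E01]) x (Leaf c) * delta c u.

(* The shuffles of vs and ws, with the exponent of the Koszul sign. *)
Fixpoint shuffles (vs : seq (tree unit cell)) :
    seq (tree unit cell) -> seq (seq (tree unit cell) * nat) :=
  match vs with
  | [::] => fun ws => [:: (ws, 0%N)]
  | v :: vs' =>
      fix shuffles_v ws :=
        match ws with
        | [::] => [:: (vs, 0%N)]
        | w :: ws' =>
            [seq (v :: r.1, r.2) | r <- shuffles vs' ws]
            ++ [seq (w :: r.1, (tdeg w * sumn (map tdeg vs) + r.2)%N)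
                   | r <- shuffles_v ws']
        end
  end.

(* The differential of Omega Com^v, i.e., the shifted L_infty relations
   d l_m(z_1, .., z_m) + .. = - sum +/- l_p(l_q(z_S), z_S'), with p, q >= 2:
   the coefficient of l_p(l_q(vs), ws) collects the shuffles of vs and ws. *)
Definition root_ops x : series := fun u =>
  match u with
  | Node _ (Node _ vs :: ws) =>
      if ws is [::] then 0 else
      - \sum_(r <- shuffles vs ws) (-1) ^+ r.2 * x (Node tt r.1)
  | _ => 0
  end.

Definition cell_boundary (c : cell) : series :=
  if c is E01 then gen V1 \- gen V0 else fun=> 0.

(* The sign exponent in the evaluation of the operation given by a tree, whose
   vertices have odd degree, on the generators decorating its leaves. *)
Fixpoint eval_sign (u : tree unit cell) : nat :=
  match u with
  | Leaf _ => 0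
  | Node _ us =>
      koszul [seq (nnodes v, in_dim v) | v <- us] + sumn (map eval_sign us)
  end.

(* The composite of the coproduct of C^1 with pi(id), which only involves the
   part of the coproduct on cogenerators, that is, the transpose of
   [transferred]:
   - the exponent [dim c] is the sign of the transpose of a map of degree -1;
   - pairing the dual of a tensor product of N odd and some even elements with
     this product gives the sign of exponent 'C(N, 2), here applied to the
     vertices and the inputs of u;
   - in arity m, invariants are identified with coinvariants by [norm]^-1, that
     is, the sum over the trees with labelled leaves is divided by m!, and each
     such tree is the average of its planar representatives, as many as the
     product of the factorials of the arities; the m! labellings of the leaves
     of a planar tree contribute equally. *)
Definition cobar_coproduct (c : cell) : series := fun u =>
  (-1) ^+ (dim c + 'C(tdeg u, 2) + eval_sign u)%N * transferred K u c
    / (\prod_(m <- arities u) m`!)%:R.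

Definition mc_d1 : series -> series :=
  extend_derivation (fun x => root_gens cell_boundary x \+ root_ops x).

(* It is -d_2 that extends the coproduct. *)
Definition mc_d2 : series -> series :=
  extend_derivation (root_gens (fun c => \- cobar_coproduct c)).

Definition mc_d x : series := mc_d1 x \+ mc_d2 x.

(* The value tau^lambda(alpha, beta). *)
Fixpoint tree_op (lambda alpha beta : series) (t : tree bool bool) : series :=
  match t with
  | Leaf black => if black then beta else alpha
  | Node _ ts => lop (rcons (map (tree_op lambda alpha beta) ts) lambda)
  end.

End MC1.

(* Main.v *)
Require Import Defs.
From mathcomp Require Import all_boot all_order all_algebra.
From mathcomp Require Import ring zify.

(* Only the finest partition of a tree u contributes to the transferred
   structure, since B Com -> Com -> End(Omega_1) vanishes outside corollas.  The
   homotopy sends f dt to x * int_0^1 f - int_0^x f, so the contribution of u is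
   zero unless each vertex has exactly one input a_01; all signs then cancel up
   to (-1)^(number of vertices), and a_01 can be moved to the last input.
   Without these inputs, u is a planar tree t with leaves a_0 and a_1, and its
   coefficient is an iterated integral where a_0 stands for 1 - x, a_1 for x.
   As (1 - x) a_0 + x a_1 = a_0 + x (a_1 - a_0), a white leaf stands for 1 and a
   black one for x.  Expanding the homotopy at each internal edge, the term
   - int_0^x keeps the edge inside a block and the term x * int_0^1 cuts it and
   leaves a factor x, as a vertex of arity 0 would.  Finally, the iterated
   integral int_0^x over a block b with p vertices is x^p / C(b), up to the
   factorials of the arities. *)

Set Implicit Arguments.
Unset Strict Implicit.
Unset Printing Implicit Defensive.

Import GRing.Theory.

Local Open Scope ring_scope.

Lemma tree_mem_ind (L A : eqType) (P : tree L A -> Prop) :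
  (forall a, P (Leaf a)) ->
  (forall l ts, {in ts, forall t, P t} -> P (Node l ts)) ->
  forall t, P t.
Proof.
move=> PL PN; elim/tree_nested_ind => // l ts IH; apply: PN.
elim: ts IH => // t ts IHts [Pt /IHts Pts] v.
by rewrite inE => /predU1P[-> //|/Pts].
Qed.

(** * Families of choices and finite sums over them *)

Section Choices.

Lemma mem_choices (T : eqType) (ss : seq (seq T)) xs :
  (xs \in choices ss) = all2 (fun x s => x \in s) xs ss.
Proof.
elim: ss xs => [|s ss IHss] [|x xs] //=.
  by apply/negbTE/negP => /allpairsP[[y ys] []].
apply/allpairsP/andP => [[[y ys] /= [s_y ys_in [-> ->]]]|[s_x xs_in]].
  by rewrite s_y -IHss.
by exists (x, xs); rewrite /= s_x IHss.
Qed.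

Lemma choices_uniq (T : eqType) (ss : seq (seq T)) :
  all uniq ss -> uniq (choices ss).
Proof.
elim: ss => //= s ss IHss /andP[Us /IHss Uss].
by apply: allpairs_uniq => // -[x xs] [y ys] _ _ /= [-> ->].
Qed.

Lemma size_choices (T I : Type) (F : I -> seq T) (ts : seq I) :
  size (choices (map F ts)) = (\prod_(t <- ts) size (F t))%N.
Proof.
elim: ts => [|t ts IHts] /=; first by rewrite big_nil.
by rewrite size_allpairs big_cons IHts.
Qed.

(** Distributivity; at a vertex it expands a product over the children into a sum over families of
    partitioned subtrees. *)
Lemma sum_choices (R : nzSemiRingType) (T I : Type) (F : I -> seq T)
    (phi : T -> I -> R) (ts : seq I) :
  \sum_(ms <- choices (map F ts)) \prod_(p <- zip ms ts) phi p.1 p.2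
  = \prod_(t <- ts) \sum_(m <- F t) phi m t.
Proof.
elim: ts => [|t ts IHts] /=; first by rewrite big_seq1 !big_nil.
rewrite big_allpairs_dep big_cons mulr_suml; apply: eq_bigr => m _.
by rewrite -IHts mulr_sumr; apply: eq_bigr => ms _; rewrite big_cons.
Qed.

Lemma size_mem_choices (T I : eqType) (F : I -> seq T) ts ws :
  ws \in choices (map F ts) -> size ws = size ts.
Proof. by rewrite mem_choices all2E size_map => /andP[/eqP]. Qed.

Lemma mem_choices_map_eq (T I : eqType) (B : Type) (F : I -> seq T)
    (f : T -> B) (g : I -> B) ts ws :
  {in ts, forall t, {in F t, forall w, f w = g t}} ->
  ws \in choices (map F ts) -> map f ws = map g ts.
Proof.
rewrite mem_choices; elim: ts ws => [|t ts IHts] [|w ws] //= fg.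
case/andP=> Fw /IHts -> => [|t' t'_ts]; last first.
  by apply: fg; rewrite inE t'_ts orbT.
by rewrite (fg t) ?inE ?eqxx.
Qed.

Lemma mem_choices_all (T I : eqType) (F : I -> seq T) (P : pred T) ts ws :
  {in ts, forall t, {in F t, forall w, P w}} ->
  ws \in choices (map F ts) -> all P ws.
Proof.
move=> FP /(mem_choices_map_eq (f := P) (g := fun=> true) FP) Pws.
by rewrite -[P]/(id \o P) -all_map Pws all_map; apply/allP.
Qed.

(** Once the zero terms are discarded, both lists are permutations of each other. This lets sums
    over generous finite lists be compared. *)
Lemma eq_big_support (R : nmodType) (I : eqType) (F : I -> R) (s l : seq I) :
  uniq s -> uniq l ->
  {in s, forall i, F i != 0 -> i \in l} ->
  {in l, forall i, F i != 0 -> i \in s} ->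
  \sum_(i <- s) F i = \sum_(i <- l) F i.
Proof.
move=> Us Ul sl ls.
have supp r : \sum_(i <- r) F i = \sum_(i <- [seq i <- r | F i != 0]) F i.
  rewrite big_filter [RHS]big_mkcond; apply: eq_bigr => i _.
  by case: eqVneq.
rewrite supp [RHS]supp; apply: perm_big; apply: uniq_perm.
- exact: filter_uniq.
- exact: filter_uniq.
move=> i; rewrite !mem_filter; case: (eqVneq (F i) 0) => //= Fi.
by apply/idP/idP => [/sl|/ls]; apply.
Qed.

End Choices.

(** * Finiteness of the set of trees of bounded size *)

Section TreeEnumeration.
Variables (L A : eqType) (ls : seq L) (els : seq A).

(** Leaves alone would not bound the number of vertices, because of arities 0 and 1. *)
Definition tsize (t : tree L A) : nat := nnodes t + nleaves t.

(** Height and arities are bounded rather than the size, so the list may contain trees of size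
    larger than [n]. *)
Fixpoint tree_enum (n : nat) : seq (tree L A) :=
  if n is n'.+1 then
    [seq Leaf a | a <- els]
    ++ [seq Node l ts | l <- ls,
          ts <- flatten [seq choices (nseq k (tree_enum n')) | k <- iota 0 (n' + 1)]]
  else [::].

Lemma tsize_Node l (ts : seq (tree L A)) :
  tsize (Node l ts) = (sumn (map tsize ts)).+1.
Proof.
rewrite /tsize /nleaves /= addSn; congr _.+1.
elim: ts => //= t ts <-; rewrite size_cat; lia.
Qed.
Hypotheses (mem_ls : forall l, l \in ls) (mem_els : forall a, a \in els).

Lemma mem_tree_enum n (t : tree L A) :
  (tsize t <= n)%N -> t \in tree_enum n.
Proof.
elim: n t => [|n IHn] t; first by case: t.
case: t => [a _|l ts]; rewrite mem_cat.
  by rewrite map_f ?mem_els.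
rewrite tsize_Node ltnS => le_n; apply/orP; right.
have tsize_gt0 : forall t : tree L A, (0 < tsize t)%N by case.
have tsP t : t \in ts -> (tsize t <= n)%N.
  move=> ts_t; apply: leq_trans le_n; case/splitPr: ts_t => a b.
  by rewrite map_cat sumn_cat /= addnCA leq_addr.
have le_ts : (size ts <= n)%N.
  apply: leq_trans le_n; elim: (ts) => //= t ts' IH.
  by rewrite -add1n leq_add.
apply: allpairs_f; first exact: mem_ls.
apply/flattenP; exists (choices (nseq (size ts) (tree_enum n))).
  by apply: map_f; rewrite mem_iota addn1 ltnS.
rewrite mem_choices; elim: ts tsP {le_n le_ts} => //= t ts IHts tsP.
rewrite IHn ?tsP ?inE ?eqxx //= IHts // => t' t'_ts.
by apply: tsP; rewrite inE t'_ts orbT.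
Qed.

End TreeEnumeration.

Lemma in_dim_Node L l (ts : seq (tree L cell)) :
  in_dim (Node l ts) = sumn (map (@in_dim L) ts).
Proof.
rewrite /in_dim /=; elim: ts => //= t ts <-.
by rewrite map_cat sumn_cat.
Qed.

Lemma nleaves_Node L A l (ts : seq (tree L A)) :
  nleaves (Node l ts) = sumn (map (@nleaves L A) ts).
Proof. by rewrite /nleaves /=; elim: ts => //= t ts <-; rewrite size_cat. Qed.

(** * Trees with one input a_01 at each vertex *)

Section Shapes.

Definition lambda : tree unit cell := Leaf E01.

(* A planar tree of type [tree unit bool] is what remains once the leaves a_01
   are removed; its leaves [false] and [true] stand for a_0 and a_1. *)
Definition endpoint (b : bool) : cell := if b then V1 else V0.

Fixpoint append_lambda (t : tree unit bool) : tree unit cell :=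
  match t with
  | Leaf b => Leaf (endpoint b)
  | Node _ ts => Node tt (rcons (map append_lambda ts) lambda)
  end.

Definition insert_lambda (ws : seq (tree unit cell)) (i : nat) :=
  take i ws ++ lambda :: drop i ws.

(** The fibre of [strip_lambda] over [t] among the trees satisfying [one_lambda]. *)
Fixpoint lambda_trees (t : tree unit bool) : seq (tree unit cell) :=
  match t with
  | Leaf b => [:: Leaf (endpoint b)]
  | Node _ ts =>
      [seq Node tt (insert_lambda ws i)
         | ws <- choices (map lambda_trees ts), i <- iota 0 (size ts + 1)]
  end.

(** The value [None] on a leaf $a_{01}$ makes [pmap] delete it from the inputs of a vertex. *)
Fixpoint strip_lambda (u : tree unit cell) : option (tree unit bool) :=
  match u with
  | Leaf V0 => Some (Leaf false)
  | Leaf V1 => Some (Leaf true)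
  | Leaf E01 => None
  | Node _ us => Some (Node tt (pmap strip_lambda us))
  end.

Fixpoint one_lambda (u : tree unit cell) : bool :=
  match u with
  | Leaf _ => true
  | Node _ us => (count_mem lambda us == 1%N) && all one_lambda us
  end.

Lemma strip_lambda_None u : (strip_lambda u == None) = (u == lambda).
Proof. by case: u => [[]|[] us]. Qed.

Lemma insert_lambdaE (B : Type) (f : tree unit cell -> B) ws i :
  map f (insert_lambda ws i) = take i (map f ws) ++ f lambda :: drop i (map f ws).
Proof. by rewrite /insert_lambda map_cat /= map_take map_drop. Qed.

Lemma strip_lambda_trees t : {in lambda_trees t, forall u, strip_lambda u = Some t}.
Proof.
elim/tree_mem_ind: t => [b|[] ts IH] u /=; first by rewrite inE => /eqP ->; case: b.
case/allpairsP=> -[ws i] /= [/(mem_choices_map_eq IH) ws_ts _ ->] /=.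
congr (Some (Node _ _)); rewrite /insert_lambda pmap_cat /= -pmap_cat cat_take_drop.
by elim: ts ws ws_ts {IH} => [|t ts IH] [|w ws] //= [-> /IH ->].
Qed.

Lemma lambda_notin t ws : ws \in choices (map lambda_trees t) -> lambda \notin ws.
Proof.
move/(mem_choices_map_eq (f := strip_lambda) (g := Some)) => ws_ts.
have {}ws_ts := ws_ts (fun t _ => @strip_lambda_trees t).
apply/negP => /(map_f strip_lambda); rewrite ws_ts.
by elim: (t).
Qed.

Lemma one_lambda_trees t : {in lambda_trees t, forall u, one_lambda u}.
Proof.
elim/tree_mem_ind: t => [b|[] ts IH] u /=; first by rewrite inE => /eqP ->.
case/allpairsP=> -[ws i] /= [ws_ts _ ->] /=.
rewrite /insert_lambda count_cat /= addnCA -count_cat cat_take_drop.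
rewrite (count_memPn (lambda_notin ws_ts)) /=.
rewrite all_cat /= -all_cat cat_take_drop.
exact: mem_choices_all IH ws_ts.
Qed.

Lemma mem_lambda_trees u t :
  one_lambda u -> strip_lambda u = Some t -> u \in lambda_trees t.
Proof.
elim/tree_mem_ind: u t => [[]|[] us IH] t //=; try by move=> _ [<-].
case/andP=> /eqP one_us wf_us [<-] {t} /=.
have us_lambda : lambda \in us by rewrite -has_pred1 has_count one_us.
case/splitPr: us_lambda one_us wf_us IH => a b.
rewrite count_cat /= addnCA add1n -count_cat => -[/eqP].
rewrite -leqn0 leqNgt -has_count has_pred1 => ab_lambda.
rewrite all_cat /= -all_cat => wf_ab IH.
have {}IH : {in a ++ b, forall u t, strip_lambda u = Some t -> u \in lambda_trees t}.
  move=> u ab_u t; apply: IH; last exact: (allP wf_ab).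
  by move: ab_u; rewrite !mem_cat inE => /orP[] ->; rewrite ?orbT.
(* The other inputs, together with the position of the removed leaf. *)
apply/allpairsP; exists (a ++ b, size a); rewrite /insert_lambda.
rewrite take_size_cat // drop_size_cat // pmap_cat /= -pmap_cat; split=> //.
  rewrite mem_choices; elim: (a ++ b) ab_lambda IH {wf_ab} => //= w ws IHws.
  rewrite inE negb_or eq_sym -strip_lambda_None => /andP[].
  case Dw: (strip_lambda w) => [t|] //= _ ws_lambda IH.
  rewrite IH ?inE ?eqxx //= IHws // => u ws_u t'.
  by apply: IH; rewrite inE ws_u orbT.
rewrite mem_iota add0n addn1 ltnS /=.
(* None of these inputs is $a_{01}$, so stripping keeps their number, and the position [size a] is
   in range. *)
have: size (pmap strip_lambda (a ++ b)) = size (a ++ b).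
  elim: (a ++ b) ab_lambda {wf_ab IH} => //= w ws IHws.
  rewrite inE negb_or eq_sym -strip_lambda_None => /andP[].
  by case: strip_lambda => //= t _ /IHws ->.
by rewrite size_cat => ->; rewrite leq_addr.
Qed.

(** Filtering out $a_{01}$ recovers the list and the index of $a_{01}$ recovers the position.
    Positions past the end would all give the same insertion, hence the bounds. *)
Lemma insert_lambda_inj ws ws' i i' :
  lambda \notin ws -> lambda \notin ws' -> (i <= size ws)%N -> (i' <= size ws')%N ->
  insert_lambda ws i = insert_lambda ws' i' -> ws = ws' /\ i = i'.
Proof.
have filterK vs j : lambda \notin vs ->
    [seq v <- insert_lambda vs j | v != lambda] = vs.
  move=> vs_lambda; rewrite filter_cat /= -filter_cat cat_take_drop.
  by apply/all_filterP/allP => v vs_v; apply: contraNneq vs_lambda => <-.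
have indexK vs j : lambda \notin vs -> (j <= size vs)%N ->
    index lambda (insert_lambda vs j) = j.
  move=> vs_lambda le_j; rewrite index_cat /= addn0 size_takel //.
  by rewrite ifN //; apply: contra vs_lambda; apply: mem_take.
move=> ws_l ws'_l le_i le_i' eq_ins; split.
  by rewrite -(filterK _ i ws_l) eq_ins filterK.
by rewrite -(indexK _ _ ws_l le_i) eq_ins indexK.
Qed.

Lemma lambda_trees_uniq t : uniq (lambda_trees t).
Proof.
elim/tree_mem_ind: t => [//|[] ts IH] /=; apply: allpairs_uniq.
- by apply: choices_uniq; apply/allP => _ /mapP[t ts_t ->]; apply: IH.
- exact: iota_uniq.
move=> p p' /allpairsP[[ws i] /= [ws_ts i_lt ->]] {p}.
case/allpairsP=> [[ws' i'] /= [ws'_ts i'_lt ->]] {p'} /= [].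
rewrite !mem_iota !add0n !addn1 !ltnS /= in i_lt i'_lt.
case/insert_lambda_inj => [|||| -> ->] //.
- exact: lambda_notin ws_ts.
- exact: lambda_notin ws'_ts.
- by rewrite (size_mem_choices ws_ts).
- by rewrite (size_mem_choices ws'_ts).
Qed.

Lemma size_lambda_trees t :
  size (lambda_trees t) = (\prod_(m <- arities t) m.+1)%N.
Proof.
elim/tree_mem_ind: t => [b|[] ts IH] /=; first by rewrite big_nil.
rewrite size_allpairs size_iota addn1 size_choices big_cons mulnC; congr muln.
by rewrite big_flatten big_map /= !big_seq; apply: eq_bigr => t /IH.
Qed.

Lemma append_lambda_mem t : append_lambda t \in lambda_trees t.
Proof.
elim/tree_mem_ind: t => [b|[] ts IH] /=; first by rewrite inE.
apply/allpairsP; exists (map append_lambda ts, size ts); split=> /=.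
- rewrite mem_choices; elim: ts IH => //= t ts IHts IH.
  rewrite IH ?inE ?eqxx //= IHts // => t' ts_t'.
  by apply: IH; rewrite inE ts_t' orbT.
- by rewrite mem_iota addn1 leqnn.
by rewrite /insert_lambda take_oversize ?drop_oversize ?size_map // cats1.
Qed.

Lemma sumn_insert_lambda (f : tree unit cell -> nat) ws i :
  sumn (map f (insert_lambda ws i)) = (f lambda + sumn (map f ws))%N.
Proof. by rewrite map_cat sumn_cat /= addnCA -sumn_cat -map_cat cat_take_drop. Qed.

Lemma nnodes_lambda_trees t : {in lambda_trees t, forall u, nnodes u = nnodes t}.
Proof.
elim/tree_mem_ind: t => [b|[] ts IH] u /=; first by rewrite inE => /eqP ->.
case/allpairsP=> -[ws i] /= [/(mem_choices_map_eq IH) ws_ts _ ->] /=.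
by rewrite sumn_insert_lambda ws_ts.
Qed.

Lemma in_dim_lambda_trees t : {in lambda_trees t, forall u, in_dim u = nnodes t}.
Proof.
elim/tree_mem_ind: t => [b|[] ts IH] u /=; first by rewrite inE => /eqP ->; case: b.
case/allpairsP=> -[ws i] /= [/(mem_choices_map_eq IH) ws_ts _ ->] /=.
by rewrite in_dim_Node sumn_insert_lambda ws_ts.
Qed.

Lemma nleaves_lambda_trees t :
  {in lambda_trees t, forall u, nleaves u = (nnodes t + nleaves t)%N}.
Proof.
elim/tree_mem_ind: t => [b|[] ts IH] u /=; first by rewrite inE => /eqP ->; case: b.
case/allpairsP=> -[ws i] /= [ws_ts _ ->] /=.
rewrite !nleaves_Node sumn_insert_lambda.
rewrite (mem_choices_map_eq IH ws_ts) addSn add1n; congr _.+1.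
by elim: (ts) => //= t ts' ->; rewrite addnACA.
Qed.

Lemma arities_lambda_trees t :
  {in lambda_trees t, forall u, arities u = map succn (arities t)}.
Proof.
elim/tree_mem_ind: t => [b|[] ts IH] u /=; first by rewrite inE => /eqP ->; case: b.
case/allpairsP=> -[ws i] /= [ws_ts _ ->] /=.
rewrite size_cat /= addnS -size_cat cat_take_drop (size_mem_choices ws_ts).
congr (_ :: _); rewrite map_cat flatten_cat /= -flatten_cat -map_cat.
rewrite cat_take_drop (mem_choices_map_eq IH ws_ts).
by elim: (ts) => //= t ts' ->; rewrite map_cat.
Qed.

(** Each vertex is odd and so is its input $a_{01}$. The total degree is thus even, and such
    subtrees commute with everything without sign. *)
Lemma tdeg_lambda_trees t u : u \in lambda_trees t -> tdeg u = (nnodes t).*2.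
Proof.
by move=> tu; rewrite /tdeg (nnodes_lambda_trees tu) (in_dim_lambda_trees tu) addnn.
Qed.

(** Chains of exchanges of sign $+1$, whose two ends are equal in the free algebra. *)
Inductive even_moves : tree unit cell -> tree unit cell -> Prop :=
| moves_refl v : even_moves v v
| moves_step s v w w' :
    ~~ odd s -> swap s v w -> even_moves w w' -> even_moves v w'.

Lemma moves_trans v w w' : even_moves v w -> even_moves w w' -> even_moves v w'.
Proof.
elim=> // s v1 v2 v3 ev_s sw _ IH /IH; exact: moves_step ev_s sw.
Qed.

Lemma moves_inside ss ts v w :
  even_moves v w -> even_moves (Node tt (ss ++ v :: ts)) (Node tt (ss ++ w :: ts)).
Proof.
elim=> [v'|s v1 v2 v3 ev_s sw _]; first exact: moves_refl.
by apply: moves_step ev_s _; apply: swap_inside.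
Qed.

(** The siblings of each $a_{01}$ have even degree, so it passes to their right without sign. *)
Lemma moves_append_lambda t : {in lambda_trees t, forall u, even_moves u (append_lambda t)}.
Proof.
elim/tree_mem_ind: t => [b|[] ts IH] u /=.
  by rewrite inE => /eqP ->; apply: moves_refl.
case/allpairsP=> -[ws i] /= [ws_ts _ ->].
have ev_ws : all (fun w => ~~ odd (tdeg w)) ws.
  apply: mem_choices_all ws_ts => t _ w /tdeg_lambda_trees ->.
  by rewrite odd_double.
(* First the input $a_{01}$ of the root is moved; the children are normalized afterwards. *)
apply: (@moves_trans _ (Node tt (rcons ws lambda))).
  rewrite /insert_lambda -cats1 -{3}(cat_take_drop i ws) -catA.
  have: all (fun w => ~~ odd (tdeg w)) (drop i ws).
    by move: ev_ws; rewrite -{1}(cat_take_drop i ws) all_cat => /andP[].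
  elim: (drop i ws) (take i ws) => [|w r IHr] l /=; first by move=> _; apply: moves_refl.
  case/andP=> ev_w /(IHr (rcons l w)); rewrite !cat_rcons.
  apply: moves_step (swap_here l lambda w r).
  by rewrite mul1n.
(* The children are treated from left to right; the empty list generalizes to the prefix [ss] of
   those already in normal form. *)
rewrite -!cats1; move: [:: lambda] => tl; rewrite -(cat0s ws) -(cat0s (map _ ts)).
move: ws_ts; rewrite mem_choices.
elim: ts [::] ws IH {ev_ws} => [|t ts IHts] ss [|w ws] //= IH.
  by move=> _; apply: moves_refl.
case/andP=> t_w /(IHts (rcons ss (append_lambda t)))/= moves_ws.
rewrite !cat_rcons in moves_ws.
rewrite -!catA !cat_cons in moves_ws *.
apply: (moves_trans _ (moves_ws _)); last first.
  by move=> t' ts_t'; apply: IH; rewrite inE ts_t' orbT.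
by apply: moves_inside; apply: IH; rewrite // inE eqxx.
Qed.

End Shapes.

(** * The transferred structure *)

Section Separated.
Variable A : eqType.

(** Every vertex is the lowest of its block exactly when the blocks are single vertices. *)
Fixpoint all_lowest (t : tree bool A) : bool :=
  match t with
  | Leaf _ => true
  | Node lowest ts => lowest && all all_lowest ts
  end.

Fixpoint separate (u : tree unit A) : tree bool A :=
  match u with
  | Leaf a => Leaf a
  | Node _ us => Node true (map separate us)
  end.

Lemma markings_uniq (u : tree unit A) : uniq (markings u).
Proof.
elim/tree_mem_ind: u => [//|l us IH] /=;
  apply: (@allpairs_uniq _ _ _ _ [:: true; false]) => //.
  by apply: choices_uniq; apply/allP => _ /mapP[u us_u ->]; apply: IH.
by move=> [b ms] [b' ms'] _ _ /= [-> ->].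
Qed.

Lemma partitions_uniq (u : tree unit A) : uniq (partitions u).
Proof.
case: u => //= l us; rewrite map_inj_uniq; last by move=> ? ? [].
by apply: choices_uniq; apply/allP => _ /mapP[u us_u ->]; apply: markings_uniq.
Qed.

Lemma separate_markings (u : tree unit A) : separate u \in markings u.
Proof.
elim/tree_mem_ind: u => [a|l us IH]; first by rewrite inE.
apply: (@allpairs_f _ _ _ _ [:: true; false]); first by [].
rewrite mem_choices; elim: us IH => //= u us IHus IH.
by rewrite IH ?inE ?eqxx // IHus // => u' us_u'; apply: IH; rewrite inE us_u' orbT.
Qed.

Lemma all_lowest_markings (u : tree unit A) :
  {in markings u, forall t, all_lowest t -> t = separate u}.
Proof.
elim/tree_mem_ind: u => [a|l us IH] t; first by rewrite inE => /eqP ->.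
case/(@allpairsP _ _ _ _ [:: true; false]) => -[b ms] [/= _ ms_us -> /andP[-> ]].
move=> low_ms; congr (Node _ _); move: ms_us low_ms; rewrite mem_choices.
elim: us ms IH => [|u us IHus] [|m ms] //= IH /andP[u_m us_ms] /andP[low_m low_ms].
congr (_ :: _); first by apply: IH; rewrite ?inE ?eqxx.
by apply: IHus => // u' us_u'; apply: IH; rewrite inE us_u' orbT.
Qed.

Lemma separate_partitions l (us : seq (tree unit A)) :
  separate (Node l us) \in partitions (Node l us).
Proof.
rewrite /= map_f // mem_choices; elim: us => //= u us ->.
by rewrite separate_markings.
Qed.

Lemma all_lowest_partitions (u : tree unit A) :
  {in partitions u, forall t, all_lowest t -> t = separate u}.
Proof.
move=> t u_t; apply: all_lowest_markings; case: u u_t => //= l us.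
case/mapP=> ms us_ms ->.
by apply: (@allpairs_f _ _ _ _ [:: true; false]).
Qed.

Lemma nnodes_separate (u : tree unit A) : nnodes (separate u) = nnodes u.
Proof.
elim/tree_mem_ind: u => //= l us IH; congr (sumn _).+1.
by rewrite -map_comp; apply/eq_in_map.
Qed.

Lemma leaves_separate (u : tree unit A) : leaves (separate u) = leaves u.
Proof.
elim/tree_mem_ind: u => //= l us IH; congr flatten.
by rewrite -map_comp; apply/eq_in_map.
Qed.

Lemma block_ids_separate low pos (u : tree unit A) :
  block_ids low pos (separate u) = iota pos (nnodes u).
Proof.
elim/tree_mem_ind: u low pos => //= l us IH _ pos; congr (_ :: _).
elim: us (pos.+1) IH => //= u us IHus pos' IH.
rewrite IH ?inE ?eqxx // nnodes_separate iotaD IHus // => u' us_u'.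
by apply: IH; rewrite inE us_u' orbT.
Qed.

Lemma inversions_iota m n : inversions (iota m n) = 0%N.
Proof.
elim: n m => //= n IHn m; rewrite IHn addn0 -size_filter.
apply/eqP; rewrite size_eq0 -(negbK (_ == _)) -has_filter -all_predC.
by apply/allP => k; rewrite mem_iota /= -leqNgt => /andP[/ltnW].
Qed.

(** The blocks are single vertices, already in prefix order, so nothing is permuted. *)
Lemma partition_sign_separate (u : tree unit A) : partition_sign (separate u) = 0%N.
Proof. by rewrite /partition_sign block_ids_separate inversions_iota. Qed.

End Separated.

(** * Products of forms on the interval and evaluation of the transferred operations *)

Section DupontProduct.
Variable K : fieldType.
Implicit Types (w : Omega1 K) (ws : seq (Omega1 K)).

Definition oprod ws : Omega1 K := foldr (@omul K) (oone K) ws.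

Lemma omul0 w : omul w 0 = 0.
Proof. by apply: Omega1_eq => /=; rewrite !mulr0 ?addr0. Qed.

Lemma omul0w w : omul 0 w = 0.
Proof. by apply: Omega1_eq => /=; rewrite !mul0r ?addr0. Qed.

Lemma oprod0 ws : 0 \in ws -> oprod ws = 0.
Proof.
elim: ws => // w ws IHws; rewrite inE => /predU1P[<-|/IHws]; first exact: omul0w.
by rewrite /oprod /= => ->; apply: omul0.
Qed.

Lemma oscale0 a : oscale a 0 = 0 :> Omega1 K.
Proof. by apply: Omega1_eq; rewrite /= scaler0. Qed.

Lemma oscale1 w : oscale 1 w = w.
Proof. by apply: Omega1_eq; rewrite /= scale1r. Qed.

Lemma oscaleA a b w : oscale a (oscale b w) = oscale (a * b) w.
Proof. by apply: Omega1_eq; rewrite /= scalerA. Qed.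

Lemma omul_scale a b w w' : omul (oscale a w) (oscale b w') = oscale (a * b) (omul w w').
Proof.
by apply: Omega1_eq; rewrite /= -!scalerAl -!scalerAr !scalerA ?scalerDr // mulrC.
Qed.

Lemma dupont_hZ a w : dupont_h (oscale a w) = oscale a (dupont_h w).
Proof.
rewrite !dupont_hE /= primZ hornerZ; apply: Omega1_eq; rewrite /= ?scaler0 //.
by rewrite scalerBr scalerA.
Qed.

Lemma dupont_pZ a w c : dupont_p (oscale a w) c = a * dupont_p w c.
Proof. by case: c; rewrite /= ?primZ hornerZ. Qed.

(** The inputs of a block that make its value zero: the zero form, or a further vertex, since the
    block is then not a corolla. *)
Definition annihilated (b : tree unit (Omega1 K * (nat * nat))) : bool :=
  if b is Leaf p then p.1 == 0 else true.

Lemma phi_block_annihilated bs :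
  has annihilated bs -> phi_block (Node tt bs) = 0.
Proof.
move=> bs0; rewrite /phi_block /= all_map.
case: ifP => [leaf_bs|_]; last exact: oscale0.
rewrite -[foldr _ _ _]/(oprod _) oprod0 ?oscale0 //.
elim: bs bs0 leaf_bs => //= b bs IHbs /orP[b0|bs0] /andP[leaf_b leaf_bs].
  by case: b b0 leaf_b => //= -[w d] /eqP /= -> _; rewrite inE eqxx.
by rewrite mem_cat IHbs ?orbT.
Qed.

(** A vertex that is not lowest enlarges the block below it, whose value is then 0; this zero
    propagates downwards through the homotopies. *)
Lemma vdl_above_annihilated t : ~~ all_lowest t -> annihilated (vdl_above K t).
Proof.
elim/tree_mem_ind: t => //= -[] ts IH //=.
rewrite -has_predC => /hasP[t ts_t low_t].
rewrite phi_block_annihilated ?dupont_hE /=; last first.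
  by apply/hasP; exists (vdl_above K t); [apply: map_f | apply: IH].
by rewrite prim0 horner0 scale0r subr0.
Qed.

(** The nested products and homotopies without their Koszul signs, which are collected in
    [eval_sign]. *)
Fixpoint dupont_eval (u : tree unit cell) : Omega1 K :=
  match u with
  | Leaf c => dupont_i K c
  | Node _ us => dupont_h (oprod (map dupont_eval us))
  end.

(** Here $t_0dt_1-t_1dt_0=(1-t)dt+t\,dt=dt$. *)
Lemma dupont_eval_lambda : dupont_eval lambda = (0, 1).
Proof. by apply: Omega1_eq; rewrite /= ?derivE; ring. Qed.

Lemma phi_block_leaves ts (f : tree unit cell -> K) (g : tree unit cell -> Omega1 K) d :
  phi_block (Node tt [seq Leaf (oscale (f t) (g t), d t) | t <- ts])
  = oscale ((-1) ^+ koszul (map d ts) * \prod_(t <- ts) f t) (oprod (map g ts)).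
Proof.
rewrite /phi_block -oscaleA; congr (oscale (_ ^+ koszul _) _) => /=.
  by elim: ts => //= t ts ->.
rewrite -map_comp all_map; case: allP => [_|[] //].
elim: ts => /= [|t ts ->]; first by rewrite big_nil oscale1.
by rewrite big_cons -omul_scale.
Qed.

Lemma sign_sumn (f : tree unit cell -> nat) us :
  \prod_(u <- us) (-1) ^+ f u = (-1) ^+ sumn (map f us) :> K.
Proof. by elim: us => [|u us IHus]; rewrite ?big_nil // big_cons exprD IHus. Qed.

Lemma vdl_above_separate u :
  vdl_above K (separate u)
  = Leaf (oscale ((-1) ^+ eval_sign u) (dupont_eval u), (nnodes u, in_dim u)).
Proof.
elim/tree_mem_ind: u => [c|l us IH] /=.
  by rewrite expr0 oscale1 /in_dim /= addn0.
rewrite -map_comp (iffLR (eq_in_map _ _ _) IH) phi_block_leaves.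
rewrite sign_sumn -exprD dupont_hZ; congr (Leaf (_, (_.+1, _))).
  by rewrite -map_comp; congr sumn; apply: eq_map => u; apply: nnodes_separate.
by rewrite /in_dim (leaves_separate (Node l us)).
Qed.

Lemma transferred_Node l us c :
  transferred K (Node l us) c
  = (-1) ^+ eval_sign (Node l us) * dupont_p (oprod (map dupont_eval us)) c.
Proof.
rewrite /transferred (bigD1_seq (separate (Node l us))) ?partitions_uniq //=; last first.
  exact: separate_partitions.
rewrite big_seq_cond big1 ?addr0 => [|t /andP[us_t ne_t]]; last first.
  have: ~~ all_lowest t.
    by apply: contra ne_t =>
      /(all_lowest_partitions (u := Node l us) us_t) ->.
  (* The root is always lowest in its block, so some child fails to be separated. *)
  case/mapP: us_t ne_t => ms _ -> _ /= low_ms.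
  rewrite phi_block_annihilated; first by case: c; rewrite /= ?prim0 horner0 mulr0.
  move: low_ms; rewrite has_map -has_predC; apply: sub_has => m.
  exact: vdl_above_annihilated.
rewrite (partition_sign_separate (Node l us)) mul1r -map_comp.
rewrite (eq_map vdl_above_separate) phi_block_leaves sign_sumn -exprD.
by rewrite dupont_pZ.
Qed.

(* The polynomial P.[1] x - P is the value of the homotopy on P' dt. *)
Fixpoint shape_poly (t : tree unit bool) : {poly K} :=
  match t with
  | Leaf b => if b then 'X else 1 - 'X
  | Node _ ts =>
      let P := prim (\prod_(q <- map shape_poly ts) q) in P.[1] *: 'X - P
  end.

(** Functions commute with $dt$, so its position does not affect the product. *)
Lemma oprod_insert (q : seq {poly K}) i :
  oprod (take i (map (pair^~ 0) q) ++ (0, 1) :: drop i (map (pair^~ 0) q))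
  = (0, \prod_(p <- q) p).
Proof.
have even_fold p w : foldr (@omul K) w (map (pair^~ 0) p)
    = (\prod_(r <- p) r * w.1, \prod_(r <- p) r * w.2).
  elim: p => [|r p IHp]; first by rewrite /= big_nil !mul1r -surjective_pairing.
  by rewrite /= IHp big_cons; apply: Omega1_eq => /=; ring.
rewrite /oprod foldr_cat /= -map_take -map_drop !even_fold.
apply: Omega1_eq => /=; first by ring.
by rewrite -[in RHS](cat_take_drop i q) big_cat /=; ring.
Qed.

Lemma dupont_eval_lambda_trees t :
  {in lambda_trees t, forall u, dupont_eval u = (shape_poly t, 0)}.
Proof.
elim/tree_mem_ind: t => [b|[] ts IH] u /=.
  by rewrite inE => /eqP -> /=; case: b; rewrite /= /t0 /t1.
case/allpairsP=> -[ws i] /= [/(mem_choices_map_eq IH) ws_ts _ ->] /=.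
rewrite insert_lambdaE ws_ts dupont_eval_lambda.
by rewrite (map_comp (pair^~ 0)) oprod_insert dupont_hE.
Qed.

Lemma oprod_lambda_trees ts us :
  Node tt us \in lambda_trees (Node tt ts) ->
  oprod (map dupont_eval us) = (0, \prod_(q <- map shape_poly ts) q).
Proof.
case/allpairsP=> -[ws i] /= [ws_ts _ [->]].
rewrite insert_lambdaE dupont_eval_lambda.
rewrite (mem_choices_map_eq (g := fun t => (shape_poly t, 0)) _ ws_ts) => [|t _].
  by rewrite (map_comp (pair^~ 0)) oprod_insert.
exact: dupont_eval_lambda_trees.
Qed.

(** Inputs other than $a_{01}$ evaluate to functions. At a vertex, the $dt$-part of the product is
    therefore 0 without any $a_{01}$, and also with several because $dt^2=0$. If this happens above
    the root, the homotopy there gives 0, which kills the whole product. *)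
Lemma oprod_not_one_lambda u :
  ~~ one_lambda u ->
  if u is Node _ us then (oprod (map dupont_eval us)).2 = 0 else True.
Proof.
elim/tree_mem_ind: u => //= l us IH; rewrite negb_and -has_predC.
case/orP=> [one_us|/hasP[v us_v /= wf_v]].
  have eval2 v : v != lambda -> (dupont_eval v).2 = 0.
    case: v => [[]|l' vs] // _.
    exact: (congr1 snd (dupont_hE (oprod (map dupont_eval vs)))).
  (* The middle clause, that the function part vanishes as soon as $dt$ occurs, is what makes the
     induction for the last one work. *)
  have: [/\ count_mem lambda us = 0%N -> (oprod (map dupont_eval us)).2 = 0,
    (0 < count_mem lambda us)%N -> (oprod (map dupont_eval us)).1 = 0
    & (1 < count_mem lambda us)%N -> (oprod (map dupont_eval us)).2 = 0].
    elim: us {IH one_us} => [//|v us [IH0 IH1 IH2]].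
    rewrite map_cons [count _ _]/= [oprod _]/(omul _ (oprod _)).
    case: (eqVneq v lambda) => [->|ne_v].
      rewrite dupont_eval_lambda add1n.
      split=> //= [_|lt1].
        by rewrite mul0r.
      by rewrite mul0r mul1r add0r IH1.
    rewrite /= (eval2 _ ne_v) mul0r addr0 add0n; split=> [/IH0|/IH1|/IH2] /= ->;
      by rewrite mulr0.
  by case: count one_us => [|[|n]] // _ [p0 _ p2]; [apply: p0 | apply: p2].
rewrite oprod0 //; apply/mapP; exists v => //.
case: v us_v wf_v => // l' vs us_v wf_v /=.
by rewrite dupont_hE (IH _ us_v wf_v) prim0 horner0 scale0r subr0.
Qed.

Lemma cobar_coproduct_not_one_lambda u :
  ~~ one_lambda u -> cobar_coproduct K E01 u = 0.
Proof.
case: u => // l us wf_u; rewrite /cobar_coproduct transferred_Node /=.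
by rewrite (oprod_not_one_lambda wf_u) prim0 horner0 !mulr0 mul0r.
Qed.

Definition shape_integral (t : tree unit bool) : K :=
  if t is Node _ ts then (prim (\prod_(q <- map shape_poly ts) q)).[1] else 0.

(** Let $n$ be the number of vertices, so that the degree is $2n$. The sign of [dim E01] cancels the
    outer one, [eval_sign] occurs twice, and $\binom{2n}2=n(2n-1)$ has the parity of $n$. Arities
    grow by one because of $a_{01}$. *)
Lemma cobar_coproduct_lambda_trees t :
  {in lambda_trees t, forall u,
     - cobar_coproduct K E01 u
     = (-1) ^+ nnodes t * shape_integral t / (\prod_(m <- arities t) m.+1`!)%:R}.
Proof.
move=> u t_u; rewrite /cobar_coproduct (arities_lambda_trees t_u) big_map.
rewrite (tdeg_lambda_trees t_u).
case: t t_u => [b|[] ts] t_u.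
  move: t_u; rewrite inE => /eqP ->.
  by rewrite /transferred /= big_nil !(mulr0, mul0r) oppr0.
have [us Du] : exists us, u = Node tt us.
  by case/allpairsP: t_u => -[ws i] [_ _ ->]; eexists.
rewrite {}Du in t_u *; rewrite transferred_Node /= (oprod_lambda_trees t_u) /=.
rewrite -mulNr; congr (_ / _).
set n := (sumn _).+1; set e := (koszul _ + _)%N.
have -> : 'C(n.*2, 2) = (n * n.*2.-1)%N by rewrite bin2 -doubleMl doubleK.
rewrite mulrA -exprD -addnA addnn -mulNr; congr (_ * _).
rewrite -[RHS]signr_odd -[X in - X]signr_odd !oddD oddM odd_double addbF /n /=.
by rewrite odd_double andbT negbK; case: odd; rewrite ?expr0 ?expr1 ?opprK.
Qed.

End DupontProduct.

(** * The sum over partitioned planar trees *)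

Section Liftings.

(** Both colours are allowed at each leaf, since black stands for $a_1-a_0$, which involves both end
    points. *)
Fixpoint papt_above (t : tree unit bool) : seq (tree bool bool) :=
  match t with
  | Leaf _ => [:: Leaf false; Leaf true]
  | Node _ ts =>
      [seq Node b ms | b <- [:: true; false], ms <- choices (map papt_above ts)]
  end.

Definition papt_on (t : tree unit bool) : seq (tree bool bool) :=
  if t is Node _ ts then [seq Node true ms | ms <- choices (map papt_above ts)]
  else [::].

Lemma papt_above_uniq t : uniq (papt_above t).
Proof.
elim/tree_mem_ind: t => [//|l ts IH] /=;
  apply: (@allpairs_uniq _ _ _ _ [:: true; false]) => //.
  by apply: choices_uniq; apply/allP => _ /mapP[t ts_t ->]; apply: IH.
by move=> [b ms] [b' ms'] _ _ /= [-> ->].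
Qed.

Lemma papt_on_uniq t : uniq (papt_on t).
Proof.
case: t => //= l ts; rewrite map_inj_uniq; last by move=> ? ? [].
by apply: choices_uniq; apply/allP => _ /mapP[t ts_t ->]; apply: papt_above_uniq.
Qed.

Lemma arities_papt_above t : {in papt_above t, forall tau, arities tau = arities t}.
Proof.
elim/tree_mem_ind: t => [b|l ts IH] tau; first by rewrite !inE => /orP[]/eqP ->.
case/(@allpairsP _ _ _ _ [:: true; false]) => -[b ms] [/= _ ms_ts ->] /=.
by rewrite (size_mem_choices ms_ts) (mem_choices_map_eq IH ms_ts).
Qed.

Lemma papt_on_above t tau :
  is_papt tau -> tau \in papt_above t -> tau \in papt_on t.
Proof.
case: tau t => [//|[] ms] // [b|l ts] _; first by rewrite !inE.
case/(@allpairsP _ _ _ _ [:: true; false]) => -[b ms'] [/= _ ms_ts [_ ->]].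
exact: map_f.
Qed.

End Liftings.

(** * Iterated integrals and the coefficients $D$ *)

Section PaptSum.
Variable K : fieldType.

Lemma primD (f g : {poly K}) : prim (f + g) = prim f + prim g.
Proof.
apply/polyP => i; rewrite coefD !coef_prim; case: i => [|i]; first by rewrite addr0.
by rewrite coefD mulrDl.
Qed.

Lemma prim_sum (I : Type) (r : seq I) (F : I -> {poly K}) :
  prim (\sum_(i <- r) F i) = \sum_(i <- r) prim (F i).
Proof. by apply: (big_morph _ primD); apply: prim0. Qed.

Lemma primXn n : prim 'X^n = n.+1%:R^-1 *: 'X^(n.+1) :> {poly K}.
Proof.
apply/polyP => i; rewrite coef_prim coefZ coefXn; case: i => [|i]; first by rewrite mulr0.
rewrite coefXn eqSS; case: eqP => [->|_]; first by rewrite mul1r mulr1.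
by rewrite mul0r mulr0.
Qed.

Definition inv_Dcoef (tau : tree bool bool) : K :=
  \prod_(b <- blocks tau) - (Ccoef b)%:R^-1.

Lemma DcoefV tau : (Dcoef K tau)^-1 = inv_Dcoef tau.
Proof.
rewrite /Dcoef /inv_Dcoef invfM -exprVn invrN1.
elim: (blocks tau) => [|b bs IHbs]; first by rewrite !big_nil expr0 mul1r invr1.
by rewrite !big_cons -IHbs /= exprS invfM; ring.
Qed.

Lemma inv_Dcoef_Node low ts :
  inv_Dcoef (Node low ts)
  = (if low then - (Ccoef (Node tt (map block_above ts)))%:R^-1 else 1)
    * \prod_(t <- ts) inv_Dcoef t.
Proof.
rewrite /inv_Dcoef /= big_cat big_flatten big_map /=; congr (_ * _).
by case: low; rewrite ?big_nil // big_seq1.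
Qed.

(* The block of the root, where the edge below it is not closed by an integral
   int_0^1, contributes the iterated integral int_0^x. *)
Definition open_poly (tau : tree bool bool) : {poly K} :=
  (inv_Dcoef tau / (Ccoef (block_above tau))%:R) *: 'X^(nnodes (block_above tau)).

Hypothesis charK0 : [pchar K] =i pred0.

Lemma natr_neq0 n : (0 < n)%N -> n%:R != 0 :> K.
Proof. by rewrite (proj1 (pcharf0P K) charK0) -lt0n. Qed.

(** Let $p_i$ be the exponent of the factor of index $i$. Integrating the product raises the
    exponent to $p=1+\sum_ip_i$, the number of vertices of the block, and divides by $p$. Up to $m!$
    this is the recursion $C(b)=m!\,p\prod_iC(b_i)$. *)
Lemma prim_open_poly ts :
  prim (\prod_(t <- ts) open_poly t)
  = ((size ts)`!%:R * (\prod_(t <- ts) inv_Dcoef t)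
       / (Ccoef (Node tt (map block_above ts)))%:R)
    *: 'X^(nnodes (Node tt (map block_above ts))).
Proof.
have -> : \prod_(t <- ts) open_poly t
    = ((\prod_(t <- ts) inv_Dcoef t)
         / (\prod_(c <- map (@Ccoef \o block_above) ts) c)%:R)
      *: 'X^(sumn (map (@nnodes _ _ \o block_above) ts)).
  elim: ts => [|t ts IHts]; first by rewrite !big_nil divr1 expr0 scale1r.
  rewrite !big_cons IHts /= natrM invfM exprD -scalerAl -scalerAr scalerA.
  by congr (_ *: _); ring.
rewrite primZ primXn scalerA /= -!map_comp size_map; congr (_ *: _).
rewrite !natrM !invfM -[LHS](mulVKf (natr_neq0 (fact_gt0 (size ts)))).
by ring.
Qed.

(** Cutting the outgoing edge closes a block, whence $-1/C$, and leaves a vertex of arity 0, whence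
    the factor $x$. Keeping it continues the integration. *)
Lemma open_poly_Node low ts (P := prim (\prod_(t <- ts) open_poly t)) :
  open_poly (Node low ts)
  = (size ts)`!%:R^-1 *: (if low then - P.[1] *: 'X else P).
Proof.
rewrite /open_poly inv_Dcoef_Node /P prim_open_poly.
have f_neq0 := natr_neq0 (fact_gt0 (size ts)).
case: low; last by rewrite /= mul1r !scalerA -!mulrA mulKf.
rewrite hornerZ hornerXn expr1n mulr1 scalerA; congr (_ *: _).
rewrite /= big_nil fact0 mul1n divr1 mulrN -[in RHS]mulrA mulKf // mulNr.
by rewrite mulrC.
Qed.

Lemma inv_Dcoef_root ts :
  inv_Dcoef (Node true ts)
  = - (size ts)`!%:R^-1 * (prim (\prod_(t <- ts) open_poly t)).[1].
Proof.
rewrite inv_Dcoef_Node prim_open_poly hornerZ hornerXn expr1n mulr1.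
by rewrite -[in RHS]mulrA !mulNr mulKf ?natr_neq0 ?fact_gt0 // mulrC.
Qed.

Definition tau_op := tree_op (gen K E01) (gen K V0) (gen K V1 \- gen K V0).

Lemma tau_op_Node b ms l ts :
  size ms = size ts ->
  tau_op (Node b ms) (append_lambda (Node l ts))
  = \prod_(p <- zip ms ts) tau_op p.1 (append_lambda p.2).
Proof.
move=> eq_ms; rewrite /tau_op /= !size_rcons !size_map eq_ms eqxx.
rewrite zip_rcons ?size_map // big_rcons /= /gen /monomial eqxx mulr1.
elim: ms ts eq_ms => [|m ms IHms] [|t ts] //= => [_|[/IHms]].
  by rewrite !big_nil.
by rewrite !big_cons => ->.
Qed.

Definition lift_poly tau t : {poly K} :=
  tau_op tau (append_lambda t) *: open_poly tau.

Lemma prod_lift_poly b ms l ts :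
  size ms = size ts ->
  \prod_(p <- zip ms ts) lift_poly p.1 p.2
  = tau_op (Node b ms) (append_lambda (Node l ts)) *: \prod_(m <- ms) open_poly m.
Proof.
move=> eq_ms; rewrite tau_op_Node //.
elim: ms ts eq_ms => [|m ms IHms] [|t ts] //= => [_|[/IHms]].
  by rewrite !big_nil scale1r.
by rewrite !big_cons => ->; rewrite -scalerAl -scalerAr scalerA.
Qed.

Definition papt_coef (t : tree unit bool) : K :=
  \prod_(m <- arities t) - m`!%:R^-1.

Lemma papt_coef_Node l ts :
  papt_coef (Node l ts) = - (size ts)`!%:R^-1 * \prod_(t <- ts) papt_coef t.
Proof. by rewrite /papt_coef /= big_cons big_flatten big_map. Qed.

Lemma sum_lift_poly_children b l ts :
  {in ts, forall t,
     \sum_(tau <- papt_above t) lift_poly tau t = papt_coef t *: shape_poly K t} ->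
  \sum_(ms <- choices (map papt_above ts))
     tau_op (Node b ms) (append_lambda (Node l ts)) *: \prod_(m <- ms) open_poly m
  = (\prod_(t <- ts) papt_coef t) *: \prod_(q <- map (shape_poly K) ts) q.
Proof.
move=> IH; transitivity (\prod_(t <- ts) \sum_(tau <- papt_above t) lift_poly tau t).
  rewrite -sum_choices !big_seq; apply: eq_bigr => ms ms_ts.
  by rewrite (prod_lift_poly b l) // (size_mem_choices ms_ts).
rewrite big_map big_seq (eq_bigr _ IH) -big_seq.
elim: ts {IH} => [|t ts IHts]; first by rewrite !big_nil scale1r.
by rewrite !big_cons IHts -scalerAl -scalerAr scalerA.
Qed.

(** At a leaf $a_0$ the two colours add up to $1-x$, and at a leaf $a_1$ to $x$. At a vertex,
    cutting or keeping the edge gives $-P(1)x$ and $P$, divided by $m!$; the sum is $-1/m!$ times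
    the homotopy applied to $P'dt$. *)
Lemma sum_lift_poly t :
  \sum_(tau <- papt_above t) lift_poly tau t = papt_coef t *: shape_poly K t.
Proof.
elim/tree_mem_ind: t => [b|l ts IH].
  rewrite /papt_coef /= big_nil scale1r !big_cons big_nil addr0 /lift_poly.
  rewrite /open_poly /inv_Dcoef /tau_op /= !big_nil fact0 mul1n /gen /monomial.
  by rewrite divr1 expr0 expr1 !scale1r; case: b => /=;
     rewrite ?(subr0, sub0r, scale0r, scale1r, scaleN1r, add0r).
rewrite /= cats0 big_cat /= !big_map -big_split /=.
(* The homotopy as a linear operator on the forms $f\,dt$, to be exchanged with the sum over the
   children. *)
pose hm (f : {poly K}) := (prim f).[1] *: 'X - prim f.
have hmZ a f : hm (a *: f) = a *: hm f.
  by rewrite /hm primZ hornerZ scalerBr scalerA.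
transitivity (- (size ts)`!%:R^-1 *: hm (\sum_(ms <- choices (map papt_above ts))
     tau_op (Node true ms) (append_lambda (Node l ts)) *: \prod_(m <- ms) open_poly m)).
  rewrite /hm prim_sum horner_sum scaler_suml -sumrB scaler_sumr !big_seq.
  apply: eq_bigr => ms ms_ts; rewrite /lift_poly !open_poly_Node /=.
  rewrite primZ hornerZ (size_mem_choices ms_ts) -!mul_polyC.
  set e1 := tau_op _ _; set e2 := tau_op _ _; have -> : e2 = e1 by [].
  by rewrite !polyCN !polyCM; ring.
by rewrite (sum_lift_poly_children _ _ IH) hmZ scalerA -(papt_coef_Node l) big_map.
Qed.

(** The lowest block is closed by the projection $\int_0^1$ instead of a homotopy. *)
Lemma sum_papt_on t :
  \sum_(tau <- papt_on t) (Dcoef K tau)^-1 * tau_op tau (append_lambda t)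
  = papt_coef t * shape_integral K t.
Proof.
case: t => [b|l ts]; first by rewrite big_nil mulr0.
rewrite papt_coef_Node -mulrA -hornerZ -primZ.
rewrite -(@sum_lift_poly_children true l) => [|t _]; last exact: sum_lift_poly.
rewrite prim_sum horner_sum mulr_sumr big_map !big_seq; apply: eq_bigr => ms ms_ts.
rewrite DcoefV inv_Dcoef_root primZ hornerZ (size_mem_choices ms_ts).
by rewrite mulrAC mulrA.
Qed.

Lemma size_arities L A (t : tree L A) : size (arities t) = nnodes t.
Proof.
elim/tree_nested_ind: t => //= l ts IH; congr _.+1.
by elim: ts IH => //= t ts IHts [eq_t /IHts]; rewrite size_cat eq_t => ->.
Qed.

(** A vertex of arity $m$ offers $m+1$ positions for $a_{01}$, all with the same coefficient, which
    turns $1/(m+1)!$ into the $1/m!$ coming from $C$. *)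
Lemma sum_papt_on_cobar t :
  {in lambda_trees t, forall u,
  \sum_(tau <- papt_on t) (Dcoef K tau)^-1 * tau_op tau (append_lambda t)
  = (size (lambda_trees t))%:R * - cobar_coproduct K E01 u}.
Proof.
move=> u t_u; rewrite sum_papt_on (cobar_coproduct_lambda_trees _ t_u).
have -> : papt_coef t = (size (lambda_trees t))%:R
    * ((-1) ^+ nnodes t / (\prod_(m <- arities t) m.+1`!)%:R).
  rewrite size_lambda_trees -size_arities /papt_coef.
  elim: (arities t) => [|m s IHs]; first by rewrite !big_nil invr1 !mulr1.
  rewrite !big_cons IHs /= factS exprS !natrM !invfM.
  by rewrite -[_^-1 in LHS](mulKf (natr_neq0 (ltn0Sn m))); ring.
by ring.
Qed.

End PaptSum.

(** * The differential of mc^1 *)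

Section Differential.
Variable K : fieldType.

Lemma extend_derivation0 (root : series K -> series K) u (x : series K) :
  (forall y, y =1 (fun=> 0) -> root y =1 (fun=> 0)) ->
  x =1 (fun=> 0) -> extend_derivation root x u = 0.
Proof.
move=> root0; elim/tree_mem_ind: u x => [c|l us IH] x x0 /=; rewrite root0 ?add0r //.
apply/eqP; rewrite oppr_eq0; apply/eqP.
elim: us [::] IH => //= v us IHus pre IH; rewrite IH ?inE ?eqxx //.
by rewrite mulr0 add0r IHus // => w us_w; apply: IH; rewrite inE us_w orbT.
Qed.

(** A generator is supported on a leaf, so the terms differentiating inside an operation vanish. *)
Lemma extend_derivation_gen (root : series K -> series K) c u :
  (forall y, y =1 (fun=> 0) -> root y =1 (fun=> 0)) ->
  extend_derivation root (gen K c) u = root (gen K c) u.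
Proof.
move=> root0; case: u => [a|l us] /=; first by rewrite addr0.
rewrite [X in - X](_ : _ = 0) ?subr0 //.
elim: us [::] => //= v us IHus pre; rewrite IHus addr0.
by rewrite extend_derivation0 ?mulr0.
Qed.

Lemma root_gens0 (delta : cell -> series K) y :
  y =1 (fun=> 0) -> root_gens delta y =1 (fun=> 0).
Proof. by move=> y0 u; rewrite /root_gens big1 // => c _; rewrite y0 mul0r. Qed.

Lemma root_ops0 (y : series K) : 
  (forall us, y (Node tt us) = 0) -> root_ops y =1 (fun=> 0).
Proof.
move=> y0 [//|l [//|[//|l' vs] [//|w ws]]] /=.
by rewrite big1 ?oppr0 // => r _; rewrite y0 mulr0.
Qed.

Lemma root_gens_gen (delta : cell -> series K) c : root_gens delta (gen K c) =1 delta c.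
Proof.
move=> u; rewrite /root_gens !big_cons big_nil /gen /monomial.
by case: c; rewrite /= ?(mul1r, mul0r, add0r, addr0).
Qed.

Lemma mc_d_gen c u :
  mc_d (gen K c) u = cell_boundary K c u - cobar_coproduct K c u.
Proof.
rewrite /mc_d /mc_d1 /mc_d2 /= !extend_derivation_gen /=.
- by rewrite !root_gens_gen root_ops0 ?addr0.
- exact: root_gens0.
by move=> y y0 v; rewrite /= root_gens0 // root_ops0 ?addr0.
Qed.

(** * Combinations of the graded symmetry relations *)

Definition null_terms
    (rs : seq ((K * nat) * (tree unit cell * tree unit cell))) u : K :=
  \sum_(r <- rs)
    r.1.1 * (monomial K r.2.1 u - (-1) ^+ r.1.2 * monomial K r.2.2 u).

Definition relations
    (rs : seq ((K * nat) * (tree unit cell * tree unit cell))) : Prop :=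
  forall r, r \in rs -> swap r.1.2 r.2.1 r.2.2.

(** The relations telescope along the chain, every exchange having sign $+1$. *)
Lemma even_moves_relations (a : K) v w :
  even_moves v w ->
  exists2 rs, relations rs
    & forall u, null_terms rs u = a * (monomial K v u - monomial K w u).
Proof.
elim=> {v w} [v|s v w w' ev_s sw _ [rs rs_swap rsE]].
  by exists [::] => // u; rewrite /null_terms big_nil subrr mulr0.
exists (((a, s), (v, w)) :: rs) => [r|u]; first by rewrite inE => /predU1P[->|/rs_swap].
rewrite /null_terms big_cons -/(null_terms rs u) rsE /= -signr_odd (negPf ev_s).
by ring.
Qed.

Lemma sum_even_moves_relations (g : tree unit cell -> K)
    (n : tree unit cell -> tree unit cell) L :
  {in L, forall v, even_moves v (n v)} ->
  exists2 rs, relations rs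
    & forall u, null_terms rs u
        = \sum_(v <- L) g v * (monomial K v u - monomial K (n v) u).
Proof.
elim: L => [_|v L IHL movesL].
  by exists [::] => // u; rewrite /null_terms !big_nil.
have [|rs rs_swap rsE] := IHL.
  by move=> w L_w; apply: movesL; rewrite inE L_w orbT.
have [|rs' rs'_swap rs'E] := @even_moves_relations (g v) v (n v).
  by apply: movesL; rewrite inE eqxx.
exists (rs' ++ rs) => [r|u]; first by rewrite mem_cat => /orP[/rs'_swap|/rs_swap].
rewrite /null_terms big_cat big_cons -/(null_terms rs' u) rs'E.
by rewrite -/(null_terms rs u) rsE.
Qed.

(** A nonzero coefficient forces the last input of each vertex of [u] to be $a_{01}$ and the other
    leaves to be end points. The shape of [tau] is then read off from [u], so finitely many [tau]
    contribute to a given [u]. *)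
Lemma tau_op_neq0 tau u :
  tau_op K tau u != 0 -> exists2 t, u = append_lambda t & tau \in papt_above t.
Proof.
elim/tree_mem_ind: tau u => [b|b ms IH] u.
  rewrite /tau_op /= /gen /monomial; case: b => /=.
    case: (u =P Leaf V1) => [->|_]; first by exists (Leaf true).
    case: (u =P Leaf V0) => [->|_]; first by exists (Leaf false).
    by rewrite subrr eqxx.
  case: (u =P Leaf V0) => [->|_]; first by exists (Leaf false).
  by rewrite eqxx.
case: u => [c|[] us]; rewrite /tau_op /= ?eqxx // size_rcons size_map.
case: (size us =P _) => [|_]; last by rewrite eqxx.
case/lastP: us => // us w; rewrite size_rcons => -[size_us].
rewrite zip_rcons ?size_map // big_rcons /= mulf_eq0 negb_or => /andP[us_neq0].
rewrite /gen {1}/monomial; case: (w =P lambda) => [-> _|]; last by rewrite eqxx.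
have [ts -> ms_ts]: exists2 ts, us = map append_lambda ts
    & ms \in choices (map papt_above ts).
  elim: ms us size_us us_neq0 IH => [|m ms IHms] [|v us] //= => [_ _ _|[size_us]].
    by exists [::].
  rewrite big_cons mulf_eq0 negb_or => /andP[v_neq0 us_neq0] IH.
  have [|t -> t_m] := IH m _ v v_neq0; first by rewrite inE eqxx.
  have [|ts -> ts_ms] := IHms us size_us us_neq0.
    by move=> m' ms_m'; apply: IH; rewrite inE ms_m' orbT.
  by exists (t :: ts) => //; rewrite mem_choices /= t_m -mem_choices.
exists (Node tt ts) => //.
by apply: (@allpairs_f _ _ _ _ [:: true; false]); rewrite //; case: (b).
Qed.

Definition papt_term (tau : tree bool bool) : series K :=
  fun u => (Dcoef K tau)^-1 * tau_op K tau u.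

Definition papt_series : series K :=
  fun u => \sum_(tau <- oapp papt_on [::] (strip_lambda u)) papt_term tau u.

Lemma strip_append_lambda t : strip_lambda (append_lambda t) = Some t.
Proof. exact: strip_lambda_trees (append_lambda_mem t). Qed.

Lemma papt_term_neq0 tau u :
  papt_term tau u != 0 -> exists2 t, u = append_lambda t & tau \in papt_above t.
Proof. by rewrite mulf_eq0 negb_or => /andP[_ /tau_op_neq0]. Qed.

(** With one $a_{01}$ at each vertex there are at most as many vertices as leaves, whence the size
    bound $2m$ for $m$ leaves. *)
Definition cell_trees (m : nat) : seq (tree unit cell) :=
  tree_enum [:: tt] [:: V0; V1; E01] m.*2.

Lemma mem_cell_trees k u :
  one_lambda u -> (nleaves u <= k)%N -> u \in cell_trees k.
Proof.
move=> wf_u le_k; apply: mem_tree_enum; [by case | by case |].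
apply: leq_trans (_ : (nleaves u).*2 <= _)%N; last by rewrite leq_double.
rewrite /tsize -addnn leq_add2r.
case Du: (strip_lambda u) => [t|].
  have t_u := mem_lambda_trees wf_u Du.
  by rewrite (nnodes_lambda_trees t_u) (nleaves_lambda_trees t_u) leq_addr.
by move/eqP: Du; rewrite strip_lambda_None => /eqP ->.
Qed.

(** The appended $a_{01}$ turns arity at least 2 into arity at least 1. *)
Lemma reduced_papt t tau :
  reduced (append_lambda t) -> tau \in papt_on t -> is_papt tau.
Proof.
rewrite /reduced (arities_lambda_trees (append_lambda_mem t)) all_map => red_t t_tau.
have above_tau: tau \in papt_above t.
  case: t t_tau {red_t} => //= l ts /mapP[ms ts_ms ->].
  exact: (@allpairs_f _ _ _ _ [:: true; false]).
have papt_arities: all (leq 1) (arities tau) by rewrite (arities_papt_above above_tau).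
by case: t t_tau {red_t above_tau} => //= l ts /mapP[ms ts_ms Dtau];
  move: papt_arities; rewrite Dtau.
Qed.

Lemma mc_sum_papt_series : mc_sum (fun (tau : papt) => papt_term (val tau)) papt_series.
Proof.
move=> k; pose ts := pmap strip_lambda (cell_trees k).
(* All partitioned trees on the shapes of trees with at most [k] leaves; [insub] discards those
   having vertices of arity 0. *)
exists (pmap insub (flatten (map papt_on ts))) => s s_uniq s_sub m lt_mk.
(* In arity below [k] the coefficients agree on the nose, without symmetry relations. *)
exists [::]; split=> // u red_u u_m; rewrite big_nil /= /papt_series.
have -> : \sum_(tau <- s) papt_term (val tau) u
    = \sum_(tau <- map val s) papt_term tau u by rewrite big_map.
apply/eqP; rewrite subr_eq0; apply/eqP; apply: eq_big_support.
- by case: strip_lambda => //= t; apply: papt_on_uniq.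
- by rewrite map_inj_uniq //; apply: val_inj.
- move=> tau + /papt_term_neq0[t Du _]; rewrite Du strip_append_lambda /= => t_tau.
  rewrite Du in red_u u_m *.
  have papt_tau := reduced_papt red_u t_tau.
  apply/mapP; exists (Sub tau papt_tau) => //; apply: s_sub.
  rewrite mem_pmap; apply/mapP; exists tau; last by rewrite insubT.
  apply/flattenP; exists (papt_on t) => //; apply: map_f.
  rewrite mem_pmap; apply/mapP; exists (append_lambda t); last by rewrite strip_append_lambda.
  apply: mem_cell_trees; last by rewrite u_m ltnW.
  exact: one_lambda_trees (append_lambda_mem t).
move=> _ /mapP[tau _ ->] /papt_term_neq0[t -> t_tau].
by rewrite strip_append_lambda; apply: papt_on_above t_tau; apply: valP.
Qed.

Hypothesis charK0 : [pchar K] =i pred0.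

(** Each tree [v] is replaced by its normal form [n v], with every $a_{01}$ in last position. The
    coefficients over the fibre of [n] at [append_lambda t] then add up to the sum over the
    partitions of [t]. *)
Lemma arity_null_cobar m :
  arity_null m (fun u => - cobar_coproduct K E01 u - papt_series u).
Proof.
pose L := undup [seq v <- cell_trees m | one_lambda v].
pose g v : K := - cobar_coproduct K E01 v.
(* The default value concerns the leaf $a_{01}$ only, where [g] vanishes. *)
pose n v := odflt v (omap append_lambda (strip_lambda v)).
have L_moves: {in L, forall v, even_moves v (n v)}.
  move=> v; rewrite mem_undup mem_filter => /andP[wf_v _]; rewrite /n.
  case Dv: (strip_lambda v) => [t|] /=; last exact: moves_refl.
  exact/moves_append_lambda/mem_lambda_trees.
have [rs rs_swap rsE] := sum_even_moves_relations g L_moves.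
exists rs; split=> // u red_u u_m; rewrite -/(null_terms rs u) rsE.
rewrite (eq_bigr _ (fun v _ => mulrBr (g v) _ _)) sumrB; congr (_ - _).
  have <-: \sum_(v <- [:: u]) g v * monomial K v u = - cobar_coproduct K E01 u.
    by rewrite big_seq1 /monomial eqxx mulr1.
  apply: eq_big_support => // [|v|v _]; first exact: undup_uniq.
    rewrite inE => /eqP ->; rewrite /monomial eqxx mulr1 oppr_eq0 => gu.
    have wf_u: one_lambda u.
      by apply: contraNT gu => /cobar_coproduct_not_one_lambda ->.
    by rewrite mem_undup mem_filter wf_u mem_cell_trees ?u_m.
  by rewrite /monomial inE; case: (u =P v) => [-> //|]; rewrite mulr0 eqxx.
have termP v : v \in L -> g v * monomial K (n v) u != 0 ->
    exists2 t, u = append_lambda t & v \in lambda_trees t.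
  rewrite mem_undup mem_filter /n => /andP[wf_v _].
  rewrite /monomial; case: (u =P _) => [-> /=|_]; last by rewrite mulr0 eqxx.
  case Dv: (strip_lambda v) => [t|] /=.
    by exists t => //; apply: mem_lambda_trees.
  move/eqP: Dv; rewrite strip_lambda_None => /eqP ->.
  by rewrite /g /cobar_coproduct /transferred big_nil !(mulr0, mul0r, oppr0) eqxx.
(* Outside the normal forms, both the fibre sum and the series are zero. *)
case Du: (strip_lambda u) => [t|]; last first.
  rewrite /papt_series Du big_nil big_seq big1 // => v L_v; apply/eqP.
  by apply/negP => /negP/(termP v L_v)[t Du' _]; rewrite Du' strip_append_lambda in Du.
case: (u =P append_lambda t) => [{}Du|ne_u]; last first.
  rewrite /papt_series Du /= !big_seq !big1 // => [v L_v|tau _]; apply/eqP/negP => /negP.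
    by case/(termP v L_v) => t' Du';
      rewrite Du' strip_append_lambda in Du; case: Du ne_u => <-.
  by case/papt_term_neq0 => t' Du';
    rewrite Du' strip_append_lambda in Du; case: Du ne_u => <-.
have u_t: u \in lambda_trees t by rewrite Du append_lambda_mem.
(* The fibre of [n] over [u] is [lambda_trees t], and [g] is constant on it. *)
transitivity (\sum_(v <- lambda_trees t) g v * monomial K (n v) u).
  rewrite /papt_series Du strip_append_lambda /= (sum_papt_on_cobar charK0 u_t).
  rewrite mulr_natl -iter_addr_0 -[size _]count_predT -big_const_seq !big_seq.
  apply: eq_bigr => v t_v; rewrite /g /n (strip_lambda_trees t_v) /=.
  rewrite /monomial -Du eqxx mulr1.
  by rewrite (cobar_coproduct_lambda_trees _ t_v)
    (cobar_coproduct_lambda_trees _ u_t).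
apply: eq_big_support => [||v t_v _|v L_v].
- exact: lambda_trees_uniq.
- exact: undup_uniq.
- have wf_v := one_lambda_trees t_v.
  rewrite mem_undup mem_filter wf_v mem_cell_trees //.
  by rewrite (nleaves_lambda_trees t_v) -(nleaves_lambda_trees u_t) u_m.
case/(termP v L_v) => t'; rewrite Du => /(congr1 strip_lambda).
by rewrite !strip_append_lambda => -[->].
Qed.

End Differential.

Theorem proposition4p6 (K : fieldType) (charK0 : [pchar K] =i pred0) :
  exists2 S : series K,
    mc_sum (fun (tau : papt) u =>
              (Dcoef K (val tau))^-1
                * tree_op (gen K E01) (gen K V0) (gen K V1 \- gen K V0)
                    (val tau) u) S
    & mc_eq (mc_d (gen K E01)) ((gen K V1 \- gen K V0) \+ S).
Proof.
exists (papt_series K); first exact: mc_sum_papt_series.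
move=> m; have [rs [rs_swap rsE]] := arity_null_cobar charK0 m.
exists rs; split=> // u red_u u_m; rewrite -rsE //= mc_d_gen /=.
by rewrite opprD addrACA subrr add0r.
Qed.
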